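(* The transform row vector $\tilde\Phi_W^T(s)=(\Phi_{W,1}(s),\dots,\Phi_{W,N}(s))$ satisfies $$\tilde\Phi_W^T(s)\,[H(s)+sI-\Lambda]=\tilde v(s),$$ where $\tilde\Phi_W^T(0)=\tilde\pi^T$, $$\tilde v(s)=(s\tilde k_1+s^2\tilde k_2-q\tilde\pi^T\Lambda M)(M+sI)^{-1},\qquad \tilde k_l=(k_{1,l},\dots,k_{N,l}),\ l=1,2,$$ and for $j=1,\dots,N$, $$k_{j,1}=q\pi_j\mu_j+\mu_jv_j^{(1)}-\lambda_jv_j^{(-1)},\qquad k_{j,2}=v_j^{(1)}+v_j^{(-1)},$$ $$v_j^{(1)}=p\sum_{i=1}^{N}p_{i,j}\beta_i^*(\lambda_j)\Phi_{W,i}(\lambda_j),\qquad v_j^{(-1)}=q\left[\pi_j-\sum_{i=1}^{N}p_{i,j}c_i^*(\mu_j)\Phi_{W,i}(\mu_j)\right].$$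
   Context: Setting (Model II). $\{Z_n\}_{n\ge0}$ is an irreducible discrete-time Markov chain on $\{1,\dots,N\}$ with transition matrix $P=(p_{i,j})$ and stationary distribution $\tilde\pi=(\pi_1,\dots,\pi_N)^T$. $W_n\ge0$ satisfies $W_{n+1}=[V_nW_n+Y_n(V_n)]^+$, $[x]^+=\max\{x,0\}$, where the $V_n$ are i.i.d., $V_n$ is independent of $W_n$, of the background chain and of the variables $S,A,C,D$, $P(V_n=1)=p\in(0,1)$, $P(V_n=-1)=q=1-p$, and $$Y_n(1)=S_n-A_{n+1},\qquad Y_n(-1)=D_{n+1}-C_n.$$ All of $S_n,A_n,C_n,D_n$ are nonnegative. Given $Z_n=i$, the pair $(A_{n+1},S_n)$ together with $Z_{n+1}$ is independent of the past and $P(A_{n+1}\le x,S_n\le y,Z_{n+1}=j\mid Z_n=i)=p_{i,j}B_i(y)(1-e^{-\lambda_jx})$; likewise $P(D_{n+1}\le x,C_n\le y,Z_{n+1}=j\mid Z_n=i)=p_{i,j}C_i(y)(1-e^{-\mu_jx})$, where $\lambda_j,\mu_j>0$ and $B_i(\cdot)$, $C_i(\cdot)$ are arbitrary distribution functions on $[0,\infty)$ with Laplace–Stieltjes transforms $\beta_i^*(s)=\int_0^\infty e^{-st}dB_i(t)$, $c_i^*(s)=\int_0^\infty e^{-st}dC_i(t)$. $\Phi_{W,i}(s)=\lim_{n\to\infty}E(e^{-sW_n}1_{\{Z_n=i\}})$, $\mathrm{Re}(s)\ge0$, where the limits are assumed to exist. $\Lambda=\mathrm{diag}(\lambda_1,\dots,\lambda_N)$,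 $M=\mathrm{diag}(\mu_1,\dots,\mu_N)$, $B^*(s)=\mathrm{diag}(\beta_1^*(s),\dots,\beta_N^*(s))$, $H(s)=pB^*(s)P\Lambda$. *)

(* Defs.v *)
From HB Require Import structures.
From mathcomp Require Import all_boot all_order all_algebra.
From mathcomp Require Import all_classical all_reals all_analysis.
From mathcomp Require Export complex.

Set Implicit Arguments.
Unset Strict Implicit.
Unset Printing Implicit Defensive.

Import Order.TTheory GRing.Theory Num.Theory.
Import numFieldNormedType.Exports.

Local Open Scope classical_set_scope.
Local Open Scope ring_scope.
Local Open Scope complex_scope.

Local Notation Re := complex.Re.
Local Notation Im := complex.Im.

Definition cexp (R : realType) (z : R[i]) : R[i] :=
  (expR (Re z) * cos (Im z)) +i* (expR (Re z) * sin (Im z)).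

Definition Cintegral (R : realType) d (T : measurableType d)
    (mu : {measure set T -> \bar R}) (D : set T) (f : T -> R[i]) : R[i] :=
  Rintegral mu D (fun x => Re (f x)) +i* Rintegral mu D (fun x => Im (f x)).

(* Laplace-Stieltjes transform of a distribution function on [0, +oo); the
   domain is closed at 0, so that a possible atom at 0 is counted. *)
Definition LST (R : realType) (F : cumulativeBounded (0 : R) (1 : R))
    (s : R[i]) : R[i] :=
  Cintegral (lebesgue_stieltjes_measure F) `[0, +oo[%classic
    (fun t : R => cexp (- s * t%:C)).

Section Events.
Context {R : realType} {d : measure_display} {T : measurableType d}.
Context (P : probability T R).

(* Only meaningful when P B != 0; every use below is guarded by this. *)
Definition cond_prob (A B : set T) : R := fine (P (A `&` B)) / fine (P B).

(* Events of the form {X in B}. *)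
Definition events (X : T -> R) : set (set T) :=
  preimage_set_system setT X measurable.

Definition state_events (N : nat) (X : T -> 'I_N) : set (set T) :=
  preimage_set_system setT X setT.

Definition independent_classes (F G : set (set T)) : Prop :=
  forall A B, F A -> G B -> P (A `&` B) = (P A * P B)%E.

Definition cond_independent_classes (E : set T) (F G : set (set T)) : Prop :=
  forall A B, F A -> G B ->
    cond_prob (A `&` B) E = cond_prob A E * cond_prob B E.

Definition mutually_independent (X : nat -> T -> R) : Prop :=
  forall (J : seq nat) (E : nat -> set R), uniq J ->
    (forall k, measurable (E k)) ->
    P (\bigcap_(k in [set` J]) (X k @^-1` E k)) =
      (\prod_(k <- J) P (X k @^-1` E k))%E.

Definition markov_chain (N : nat) (Pm : 'M[R]_N) (Z : nat -> T -> 'I_N) : Prop :=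
  forall n (h : nat -> 'I_N) (j : 'I_N),
    let history := [set w | forall k, (k <= n)%N -> Z k w = h k] in
    P history != 0%E ->
    cond_prob (Z n.+1 @^-1` [set j]) history = Pm (h n) j.

End Events.

Section TransitionMatrix.
Context {R : realType} {N : nat}.
Implicit Types (Pm : 'M[R]_N) (pst : 'rV[R]_N).

Definition stochastic Pm : Prop :=
  (forall i j, 0 <= Pm i j) /\ (forall i, \sum_j Pm i j = 1).

Definition irreducible Pm : Prop :=
  forall i j, exists n : nat, 0 < (Pm ^+ n) i j.

Definition stationary Pm pst : Prop :=
  [/\ forall j, 0 <= pst 0 j, \sum_j pst 0 j = 1 & pst *m Pm = pst].

End TransitionMatrix.

Section Model.
Context {R : realType} {d : measure_display} {T : measurableType d}.
Context (P : probability T R) {N : nat}.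
Context (p : R) (Pm : 'M[R]_N) (lam mu : 'I_N -> R).
Context (FB FC : 'I_N -> cumulativeBounded (0 : R) (1 : R)).
Context (Z : nat -> T -> 'I_N).
Context (W V S A C D : nat -> {RV P >-> R}).
Context (Y : nat -> R -> T -> R).

(* The past at time n.  As A (n+1) and D (n+1) are paired with S n and C n, they
   belong to the step from n to n+1; A 0 and D 0 never occur. *)
Definition past (n : nat) : set (set T) :=
  <<s \bigcup_(k in [set k | (k <= n)%N]) (events (W k) `|` state_events (Z k))
      `|`
      \bigcup_(k in [set k | (k < n)%N])
        (events (V k) `|` events (S k) `|` events (A k.+1)
         `|` events (C k) `|` events (D k.+1)) >>.

Definition triple_events (X X' : T -> R) (n : nat) : set (set T) :=
  <<s events X `|` events X' `|` state_events (Z n.+1) >>.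

(* Everything V n has to be independent of. *)
Definition input_events (n : nat) : set (set T) :=
  <<s events (W n)
      `|`
      \bigcup_k (state_events (Z k) `|` events (S k) `|` events (A k.+1)
                 `|` events (C k) `|` events (D k.+1)) >>.

(* Given Z n = i, the pair (X, X') together with Z (n+1) is independent of the
   past, X' has distribution function F i, and X is exponential with a rate
   rho j depending on the value j of Z (n+1). *)
Definition modulated_pair (F : 'I_N -> cumulativeBounded (0 : R) (1 : R))
    (rho : 'I_N -> R) (X X' : T -> R) (n : nat) : Prop :=
  forall i, P (Z n @^-1` [set i]) != 0%E ->
    cond_independent_classes P (Z n @^-1` [set i])
      (triple_events X X' n) (past n)
    /\ forall (j : 'I_N) (x y : R), 0 <= x -> 0 <= y ->
         cond_prob P [set w | [/\ X w <= x, X' w <= y & Z n.+1 w = j]]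
           (Z n @^-1` [set i])
         = Pm i j * F i y * (1 - expR (- (rho j * x))).

Record modelII : Prop := ModelII {
  p_gt0 : 0 < p;
  p_lt1 : p < 1;
  lam_gt0 : forall j, 0 < lam j;
  mu_gt0 : forall j, 0 < mu j;
  FB_supp : forall i y, y < 0 -> FB i y = 0;
  FC_supp : forall i y, y < 0 -> FC i y = 0;
  Z_measurable : forall n i, measurable (Z n @^-1` [set i]);
  Z_stochastic : stochastic Pm;
  Z_irreducible : irreducible Pm;
  Z_markov : markov_chain P Pm Z;
  W_ge0 : forall n w, 0 <= W n w;
  S_ge0 : forall n w, 0 <= S n w;
  A_ge0 : forall n w, 0 <= A n.+1 w;
  C_ge0 : forall n w, 0 <= C n w;
  D_ge0 : forall n w, 0 <= D n.+1 w;
  (* V n takes the values 1 and -1 almost surely, so the values of Y n v for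
     other v are irrelevant. *)
  Y_pos : forall n w, Y n 1 w = S n w - A n.+1 w;
  Y_neg : forall n w, Y n (-1) w = D n.+1 w - C n w;
  W_rec : forall n w,
    W n.+1 w = Num.max (V n w * W n w + Y n (V n w) w) 0;
  V_pos : forall n, P (V n @^-1` [set 1]) = p%:E;
  V_neg : forall n, P (V n @^-1` [set -1]) = (1 - p)%:E;
  V_indep : mutually_independent P V;
  V_indep_input : forall n,
    independent_classes P (events (V n)) (input_events n);
  AS_law : forall n, modulated_pair FB lam (A n.+1) (S n) n;
  DC_law : forall n, modulated_pair FC mu (D n.+1) (C n) n
}.

(* E (e^{-s W_n} 1_{Z_n = i}) *)
Definition transformW (n : nat) (i : 'I_N) (s : R[i]) : R[i] :=
  Cintegral P setT
    (fun w => cexp (- s * (W n w)%:C) * (\1_(Z n @^-1` [set i]) w)%:C).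

(* R[i]^o carries the topology of the modulus on R[i]. *)
Definition transforms_converge : Prop :=
  forall (i : 'I_N) (s : R[i]), 0 <= Re s ->
    cvg ((transformW n i s : R[i]^o) @[n --> \oo]).

Definition PhiW (i : 'I_N) (s : R[i]) : R[i] :=
  lim ((transformW n i s : R[i]^o) @[n --> \oo]).

Definition PhiW_row (s : R[i]) : 'rV[R[i]]_N := \row_i PhiW i s.

Definition toC_mx m n (X : 'M[R]_(m, n)) : 'M[R[i]]_(m, n) :=
  map_mx (fun x : R => x%:C) X.

Definition diagC (a : 'I_N -> R) : 'M[R[i]]_N := diag_mx (\row_j (a j)%:C).

Definition Bstar (s : R[i]) : 'M[R[i]]_N := diag_mx (\row_i LST (FB i) s).

Definition Hmx (s : R[i]) : 'M[R[i]]_N :=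
  p%:C *: (Bstar s *m toC_mx Pm *m diagC lam).

Section Coefficients.
Context (pst : 'rV[R]_N).
Let q : R := 1 - p.

Definition v_pos (j : 'I_N) : R[i] :=
  p%:C * \sum_i (Pm i j)%:C * LST (FB i) (lam j)%:C * PhiW i (lam j)%:C.

Definition v_neg (j : 'I_N) : R[i] :=
  q%:C * ((pst 0 j)%:C
          - \sum_i (Pm i j)%:C * LST (FC i) (mu j)%:C * PhiW i (mu j)%:C).

Definition k1 : 'rV[R[i]]_N :=
  \row_j (q%:C * (pst 0 j)%:C * (mu j)%:C
          + (mu j)%:C * v_pos j - (lam j)%:C * v_neg j).

Definition k2 : 'rV[R[i]]_N := \row_j (v_pos j + v_neg j).

Definition vrow (s : R[i]) : 'rV[R[i]]_N :=
  (s *: k1 + s ^+ 2 *: k2 - q%:C *: (toC_mx pst *m diagC lam *m diagC mu))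
  *m invmx (diagC mu + s%:M).

End Coefficients.
End Model.

(* Main.v *)
Require Import Defs.
From HB Require Import structures.
From mathcomp Require Import all_boot all_order all_algebra.
From mathcomp Require Import all_classical all_reals all_analysis complex.
From mathcomp Require Import measurable_realfun ring lra.
Import GRing.Theory Num.Theory.
Import numFieldNormedType.Exports.
Local Open Scope ring_scope.

(** Condition on the pair of consecutive states (i, j).  When V_n = 1 the next
workload is (X - A)^+ with X = W_n + S_n, where A is exponential with rate l
and independent of X >= 0, and
  (s - l) E e^{-s (X - A)^+} = s e^{-l X} - l e^{-s X};
when V_n = -1 it is (D - X)^+ with X = W_n + C_n, and
  (s + m) E e^{-s (D - X)^+} = s + m - s e^{-m X}.
As W_n and S_n (or C_n) are independent given Z_n = i, e^{-s X} has expectation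
LST(s) E e^{-s W_n}.  Summing over i and over the two values of V_n gives a
recursion for the transforms of W_n multiplied by (s - lambda_j)(s + mu_j), so
that the pole at s = lambda_j never appears, and it passes to the limit.  At
s = 0 it says that the limit is an invariant vector of P of total mass 1,
hence the stationary distribution. *)

Set Implicit Arguments.
Unset Strict Implicit.
Unset Printing Implicit Defensive.

Import Order.TTheory.

Local Open Scope classical_set_scope.
Local Open Scope complex_scope.

Local Notation Re := complex.Re.
Local Notation Im := complex.Im.

(** * Complex-valued bounded measurable functions *)

(** The model prescribes distribution functions conditionally on Z_n = i, whereas the computation
    integrates W_n, a service time and an exponential variable over the event {Z_n = i, Z_{n+1} =
    j}. The bridge is made with unnormalised measures: P restricted to an event and pushed forward.
    Conditional probabilities are multiplied out once, with a case split on P(Z_n = i) = 0; from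
    then on every law in question is a constant times a known measure, hence determined by its
    values on rays or rectangles, and Fubini applies. The two claims of the theorem are not
    independent. The recursion contains sum_i p_ij Phi_i(0) in the place where the coefficients have
    pi_j, so the value at s = 0 has to be identified before the equation for general s can be put in
    the stated form. *)

Section ComplexArith.
Context {R : realType}.
Implicit Types (x y : R[i]) (r : R).

Lemma complexP x y : Re x = Re y -> Im x = Im y -> x = y.
Proof. by case: x y => a b [c d] /= -> ->. Qed.

Lemma ReD x y : Re (x + y) = Re x + Re y. Proof. by case: x y => ? ? []. Qed.
Lemma ImD x y : Im (x + y) = Im x + Im y. Proof. by case: x y => ? ? []. Qed.
Lemma ReN x : Re (- x) = - Re x. Proof. by case: x. Qed.
Lemma ImN x : Im (- x) = - Im x. Proof. by case: x. Qed.
Lemma ReM x y : Re (x * y) = Re x * Re y - Im x * Im y.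
Proof. by case: x y => ? ? []. Qed.
Lemma ImM x y : Im (x * y) = Re x * Im y + Im x * Re y.
Proof. by case: x y => ? ? []. Qed.

Definition ReIm := (ReD, ImD, ReN, ImN, ReM, ImM).

Lemma cexpD x y : cexp (x + y) = cexp x * cexp y.
Proof.
apply: complexP; rewrite !ReIm /= ?ReIm expRD ?cosD ?sinD; ring.
Qed.

Lemma cexp0 : cexp 0 = 1 :> R[i].
Proof. by apply: complexP => /=; rewrite expR0 ?cos0 ?sin0 ?mulr1 ?mulr0. Qed.

End ComplexArith.

Section BoundedMeasurable.
Context {R : realType} {d} {T : measurableType d}.
Implicit Types (f g : T -> R) (h : T -> R[i]).

(** [Rintegral] has a meaningless value on functions that are not integrable, so linearity needs
    integrability each time. This class is integrable for every finite measure and closed under the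
    operations that occur. *)
Definition bounded_mfun f :=
  measurable_fun setT f /\ exists M, forall x, `|f x| <= M.

Lemma bounded_mfun_cst r : bounded_mfun (fun _ => r).
Proof. by split; [exact: measurable_cst|exists `|r|]. Qed.

Lemma bounded_mfunD f g : bounded_mfun f -> bounded_mfun g ->
  bounded_mfun (fun x => f x + g x).
Proof.
move=> [mf [M fM]] [mg [N gN]]; split; first exact: measurable_funD.
by exists (M + N) => x; rewrite (le_trans (ler_normD _ _))// lerD.
Qed.

Lemma bounded_mfunM f g : bounded_mfun f -> bounded_mfun g ->
  bounded_mfun (fun x => f x * g x).
Proof.
move=> [mf [M fM]] [mg [N gN]]; split; first exact: measurable_funM.
by exists (M * N) => x; rewrite normrM ler_pM.
Qed.

Lemma bounded_mfunN f : bounded_mfun f -> bounded_mfun (fun x => - f x).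
Proof.
move=> [mf [M fM]]; split; first exact: measurableT_comp.
by exists M => x; rewrite normrN.
Qed.

Lemma bounded_mfunB f g : bounded_mfun f -> bounded_mfun g ->
  bounded_mfun (fun x => f x - g x).
Proof. by move=> bf bg; apply: bounded_mfunD => //; exact: bounded_mfunN. Qed.

Lemma bounded_mfun_integrable (m : {finite_measure set T -> \bar R}) D f :
  measurable D -> bounded_mfun f -> m.-integrable D (EFin \o f).
Proof.
move=> mD [mf [M fM]]; apply: measurable_bounded_integrable => //.
- by rewrite -ge0_fin_numE// fin_num_measure.
- exact: measurable_funTS.
- exists M; split; first exact: num_real.
  by move=> N MN x _ /=; apply: (le_trans (fM x)); exact: ltW.
Qed.

Definition bounded_cmfun h :=
  bounded_mfun (fun x => Re (h x)) /\ bounded_mfun (fun x => Im (h x)).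

Lemma bounded_cmfun_cst c : bounded_cmfun (fun _ => c).
Proof. by split; exact: bounded_mfun_cst. Qed.

Lemma bounded_cmfunN h : bounded_cmfun h -> bounded_cmfun (fun x => - h x).
Proof.
move=> [rh ih]; split.
  by under eq_fun do rewrite ReN; exact: bounded_mfunN.
by under eq_fun do rewrite ImN; exact: bounded_mfunN.
Qed.

Lemma bounded_cmfunM h k : bounded_cmfun h -> bounded_cmfun k ->
  bounded_cmfun (fun x => h x * k x).
Proof.
move=> [rh ih] [rk ik]; split.
  by under eq_fun do rewrite ReM; apply: bounded_mfunB; exact: bounded_mfunM.
by under eq_fun do rewrite ImM; apply: bounded_mfunD; exact: bounded_mfunM.
Qed.

End BoundedMeasurable.

Lemma bounded_cmfun_comp {R : realType} {d d'} {T : measurableType d}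
  {T' : measurableType d'} (h : T' -> R[i]) (u : T -> T') :
  measurable_fun setT u -> bounded_cmfun h -> bounded_cmfun (h \o u).
Proof.
move=> mu [[mr [M rM]] [mi [N iN]]]; split; split.
- exact: (measurableT_comp mr mu).
- by exists M => x; exact: rM.
- exact: (measurableT_comp mi mu).
- by exists N => x; exact: iN.
Qed.

Lemma eq_Cintegral {R : realType} {d} {T : measurableType d}
    (m : {measure set T -> \bar R}) D (f g : T -> R[i]) :
  (forall x, D x -> f x = g x) -> Cintegral m D f = Cintegral m D g.
Proof.
by move=> fg; congr (_ +i* _); apply: eq_Rintegral => x /set_mem Dx /=;
  rewrite fg.
Qed.

Section Cintegral.
Context {R : realType} {d} {T : measurableType d}.
Context (m : {finite_measure set T -> \bar R}).
Implicit Types (D : set T) (f g : T -> R[i]).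

Lemma CintegralD D f g : measurable D -> bounded_cmfun f -> bounded_cmfun g ->
  Cintegral m D (fun x => f x + g x) = Cintegral m D f + Cintegral m D g.
Proof.
move=> mD [rf fi] [rg gi]; apply: complexP; rewrite ReIm /=.
  by under eq_Rintegral do rewrite ReD;
    rewrite RintegralD//; exact: bounded_mfun_integrable.
by under eq_Rintegral do rewrite ImD;
  rewrite RintegralD//; exact: bounded_mfun_integrable.
Qed.

Lemma CintegralZl D c f : measurable D -> bounded_cmfun f ->
  Cintegral m D (fun x => c * f x) = c * Cintegral m D f.
Proof.
move=> mD [rf fi]; apply: complexP; rewrite ReIm /=.
  under eq_Rintegral do rewrite ReM.
  rewrite RintegralB//; try by apply: bounded_mfun_integrable => //;
    apply: bounded_mfunM => //; exact: bounded_mfun_cst.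
  by rewrite !RintegralZl//; exact: bounded_mfun_integrable.
under eq_Rintegral do rewrite ImM.
rewrite RintegralD//; try by apply: bounded_mfun_integrable => //;
  apply: bounded_mfunM => //; exact: bounded_mfun_cst.
by rewrite !RintegralZl//; exact: bounded_mfun_integrable.
Qed.

Lemma Cintegral_cst D c : measurable D ->
  Cintegral m D (fun=> c) = c * (fine (m D))%:C.
Proof.
move=> mD; apply: complexP; rewrite ReIm /= Rintegral_cst//.
  by rewrite mulr0 subr0.
by rewrite mulr0 add0r.
Qed.

Lemma CintegralB D f g : measurable D -> bounded_cmfun f -> bounded_cmfun g ->
  Cintegral m D (fun x => f x - g x) = Cintegral m D f - Cintegral m D g.
Proof.
move=> mD cf cg; rewrite CintegralD//; last exact: bounded_cmfunN.
rewrite -[in RHS]mulN1r -CintegralZl//.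
by congr (_ + _); apply: eq_Cintegral => x _; rewrite mulN1r.
Qed.

Lemma Cintegral_setU A B f : measurable A -> measurable B -> bounded_cmfun f ->
  [disjoint A & B] ->
  Cintegral m (A `|` B) f = Cintegral m A f + Cintegral m B f.
Proof.
move=> mA mB [rf fi] AB; have mAB := measurableU _ _ mA mB.
apply: complexP; rewrite ReIm /= Rintegral_setU//; exact: bounded_mfun_integrable.
Qed.

Lemma Cintegral_null D f : measurable D -> m D = 0 -> bounded_cmfun f ->
  Cintegral m D f = 0.
Proof.
have H (g : T -> R) : measurable D -> m D = 0 -> bounded_mfun g ->
    Rintegral m D g = 0.
  move=> mD D0 bg; rewrite /Rintegral (negligible_integral mD mD)//.
    by rewrite setDv integral_set0.
  exact: bounded_mfun_integrable.
by move=> mD D0 [rf fi]; apply: complexP => /=; rewrite H.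
Qed.

Lemma Cintegral_setT_indic E f : measurable E ->
  Cintegral m setT (fun x => f x * (\1_E x)%:C) = Cintegral m E f.
Proof.
move=> mE; apply: complexP => /=; rewrite [RHS]Rintegral_mkcond;
  apply: eq_Rintegral => x _; rewrite ReIm /= patchE indicE;
  by case: (x \in E) => /=; rewrite ?mulr0 ?mulr1 ?subr0 ?add0r.
Qed.

Lemma Cintegral_partition (I : finType) (E : I -> set T) f :
  (forall i, measurable (E i)) -> trivIset setT E -> bounded_cmfun f ->
  Cintegral m (\bigcup_i E i) f = \sum_i Cintegral m (E i) f.
Proof.
move=> mE tE cf.
have -> : \bigcup_i E i = \big[setU/set0]_(i <- enum I) E i.
  rewrite -bigcup_seq; apply: eq_bigcupl; split=> i //= _.
  by rewrite mem_enum.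
rewrite -[RHS]big_enum/=.
(* Uniqueness of the list is carried through the induction: it makes the set at the head disjoint
   from the union over the tail. *)
elim: (enum I) (enum_uniq I) => [_|i s IH /= /andP[si us]].
  by rewrite !big_nil Cintegral_null// measure0.
rewrite !big_cons Cintegral_setU ?IH//.
  exact: bigsetU_measurable.
apply/disj_setPS => x [Eix]; rewrite -bigcup_seq => -[j /= js Ejx].
have ij : i = j by apply: (tE i j) => //; exists x.
by move: si; rewrite ij js.
Qed.

End Cintegral.

(** * Laws, independence and product measures *)

Section LawOn.
Context {R : realType} {d d'} {T : measurableType d} {T' : measurableType d'}.
Context (P : {finite_measure set T -> \bar R}).

Definition law_on (E : set T) (mE : measurable E) (X : T -> T')
    (mX : measurable_fun setT X) : set T' -> \bar R :=
  pushforward (mrestr P mE) X.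

Context (E : set T) (mE : measurable E) (X : T -> T').
Context (mX : measurable_fun setT X).

Local Notation law := (law_on mE mX).

Lemma law_onE A : law A = P (X @^-1` A `&` E).
Proof. by []. Qed.

Let law0 : law set0 = 0%E.
Proof. by rewrite law_onE preimage_set0 set0I measure0. Qed.

Let law_ge0 A : (0 <= law A)%E.
Proof. exact: measure_ge0. Qed.

Let law_sigma_additive : semi_sigma_additive law.
Proof.
exact: (@measure_semi_sigma_additive _ _ _ (pushforward (mrestr P mE) X)).
Qed.

HB.instance Definition _ := isMeasure.Build _ _ _
  law law0 law_ge0 law_sigma_additive.

Let law_fin : fin_num_fun law.
Proof.
move=> A mA; rewrite law_onE fin_num_measure//; apply: measurableI => //.
by rewrite -[X in measurable X]setTI; exact: mX.
Qed.

HB.instance Definition _ := @Measure_isFinite.Build _ _ _ law law_fin.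

Lemma integral_law_on (f : T' -> R) : bounded_mfun f ->
  (\int[law]_x (f x)%:E = \int[P]_(x in E) (f (X x))%:E)%E.
Proof.
move=> bf.
have bfX : bounded_mfun (f \o X).
  have [mf [M fM]] := bf; split; first exact: (measurableT_comp mf mX).
  by exists M => x; exact: fM.
have -> : (\int[law]_x (f x)%:E =
           \int[mrestr P mE]_x (EFin \o (f \o X)) x)%E.
  apply: (etrans (integral_pushforward mX (mu := mrestr P mE) _ _ _)) => //.
    - by apply/measurable_EFinP; exact: bf.1.
  - exact: (bounded_mfun_integrable (mrestr P mE) measurableT bfX).
(* The restricted measure vanishes on the complement of E and agrees with P on the measurable
   subsets of E. *)
rewrite (negligible_integral (measurableC mE))//; last 2 first.
- exact: bounded_mfun_integrable.
- by rewrite /= /mrestr setICl measure0.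
rewrite setTD setCK; apply: eq_measure_integral => A mA AE.
by rewrite /= /mrestr setIidl.
Qed.

End LawOn.

Section Uniqueness.
Context {R : realType}.

(* [measurableTypeR R] rather than [R]: this is the measurable structure carried
   by [lebesgue_stieltjes_measure] and [exponential_prob], and its display is not
   the default one of [R]. *)
Lemma finite_measure_eq_on_rays
    (m1 m2 : {finite_measure set (measurableTypeR R) -> \bar R}) :
  (forall x, m1 `]-oo, x]%classic = m2 `]-oo, x]%classic) ->
  forall A, measurable A -> m1 A = m2 A.
Proof.
move=> m12.
pose G :=
  [set A : set (measurableTypeR R) | exists x, A = `]-oo, x]%classic].
apply: (@measure_unique _ R (measurableTypeR R) G (fun n => `]-oo, n%:R]%classic)).
(* The closed rays []-oo, x]] generate the Borel sets because they are the complements of the open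
   rays []x, +oo[], a known generator. *)
- apply: (etrans (RGenOInfty.measurableE R)); apply/seteqP; split.
    apply: smallest_sub; first exact: smallest_sigma_algebra.
    move=> _ [x ->]; rewrite -setCitvl.
    apply: (@measurableC _ (g_sigma_algebraType G)).
    by apply: sub_sigma_algebra; exists x.
  apply: smallest_sub; first exact: smallest_sigma_algebra.
  move=> _ [x ->]; rewrite -setCitvr.
  apply: (@measurableC _ (g_sigma_algebraType (@RGenOInfty.G R))).
  by apply: sub_sigma_algebra; exists x.
- move=> _ _ [x ->] [y ->]; exists (Num.min x y).
  apply/seteqP; split => z /=; rewrite !in_itv/= le_min; first by case=> -> ->.
  by move=> /andP[].
- by move=> n; exists n%:R.
- apply/seteqP; split => // x _; exists (Num.truncn x).+1 => //=.
  by rewrite in_itv/= ltW// truncnS_gt.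
- by move=> _ [x ->]; exact: m12.
- by move=> n; rewrite -ge0_fin_numE// fin_num_measure.
Qed.

Lemma finite_measure_eq_on_rectangles {d1 d2} {T1 : measurableType d1}
    {T2 : measurableType d2}
    (m1 m2 : {finite_measure set (T1 * T2)%type -> \bar R}) :
  (forall A B, measurable A -> measurable B -> m1 (A `*` B) = m2 (A `*` B)) ->
  forall C, measurable C -> m1 C = m2 C.
Proof.
move=> m12.
pose G : set (set (T1 * T2)) :=
  [set A `*` B | A in (@measurable d1 T1) & B in (@measurable d2 T2)].
apply: (measure_unique G (fun=> setT)).
- by rewrite measurable_prod_measurableType.
- move=> _ _ [A1 mA1 [B1 mB1 <-]] [A2 mA2 [B2 mB2 <-]]; rewrite -setXI.
  by exists (A1 `&` A2); [exact: measurableI|exists (B1 `&` B2);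
    [exact: measurableI|]].
- by move=> _; exists setT => //; exists setT => //; rewrite setXTT.
- by rewrite bigcup_const//; exists 0%N.
- by move=> _ [A mA [B mB <-]]; exact: m12.
- by move=> n; rewrite -ge0_fin_numE// fin_num_measure.
Qed.

End Uniqueness.

Section ScaledMeasure.
Context {R : realType} {d} {T : measurableType d}.
Context (m : {finite_measure set T -> \bar R}) (c : R) (c0 : 0 <= c).

(** A name of its own for [mscale] lets it carry the structure of a finite measure, as the
    uniqueness lemmas above require of both measures compared. *)
Definition scaled : set T -> \bar R := mscale (NngNum c0) m.

Lemma scaledE A : scaled A = (c%:E * m A)%E.
Proof. by []. Qed.

HB.instance Definition _ := Measure.copy scaled (mscale (NngNum c0) m).

Let scaled_fin : fin_num_fun scaled.
Proof. by move=> A mA; rewrite scaledE fin_numM// fin_num_measure. Qed.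

HB.instance Definition _ := @Measure_isFinite.Build _ _ _ scaled scaled_fin.

End ScaledMeasure.

Section IntegralScaled.
Context {R : realType} {d} {T : measurableType d}.
Context (m : {finite_measure set T -> \bar R}) (c : R) (c0 : 0 <= c).

Lemma Rintegral_scaled f : bounded_mfun f ->
  Rintegral (scaled m c0) setT f = c * Rintegral m setT f.
Proof.
move=> bf; have mf : measurable_fun setT (EFin \o f).
  by apply/measurable_EFinP; exact: bf.1.
have fi := bounded_mfun_integrable m measurableT bf.
rewrite /Rintegral integralE [in RHS]integralE.
rewrite (@ge0_integral_mscale _ _ _ m setT measurableT (NngNum c0));
  [|exact: measurable_funepos|by []].
rewrite (@ge0_integral_mscale _ _ _ m setT measurableT (NngNum c0));
  [|exact: measurable_funeneg|by []].
have fp : (\int[m]_x (EFin \o f)^\+ x)%E \is a fin_num.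
  by apply: integrable_fin_num => //; exact: integrable_funepos.
have fn : (\int[m]_x (EFin \o f)^\- x)%E \is a fin_num.
  by apply: integrable_fin_num => //; exact: integrable_funeneg.
by rewrite -muleBr ?fin_num_adde_defr// fineM// fin_numB fp fn.
Qed.

Lemma Cintegral_scaled f : bounded_cmfun f ->
  Cintegral (scaled m c0) setT f = c%:C * Cintegral m setT f.
Proof.
by move=> [rf fi]; apply: complexP; rewrite ReIm /= Rintegral_scaled// mul0r
  ?subr0 ?addr0.
Qed.

End IntegralScaled.

Section Transfer.
Context {R : realType} {d d'} {T : measurableType d} {T' : measurableType d'}.
Context (P : {finite_measure set T -> \bar R}).

Lemma Cintegral_law_on (E : set T) (mE : measurable E) (X : T -> T')
    (mX : measurable_fun setT X) h : bounded_cmfun h ->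
  Cintegral P E (fun w => h (X w)) = Cintegral (law_on P mE mX) setT h.
Proof.
by move=> [rh ih]; apply: complexP; rewrite /= /Rintegral
  (@integral_law_on _ _ _ _ _ _ _ mE _ mX).
Qed.

(** Serves two purposes: with c = p or 1 - p it removes the event that fixes V_n, and with c = p_ij
    it passes from {Z_n = i, Z_{n+1} = j} to {Z_n = i}. *)
Lemma Cintegral_proportional (E1 E2 : set T) (X1 X2 : T -> T') (c : R) h :
  measurable E1 -> measurable E2 ->
  measurable_fun setT X1 -> measurable_fun setT X2 -> 0 <= c ->
  (forall A, measurable A ->
     P (X1 @^-1` A `&` E1) = (c%:E * P (X2 @^-1` A `&` E2))%E) ->
  bounded_cmfun h ->
  Cintegral P E1 (fun w => h (X1 w)) = c%:C * Cintegral P E2 (fun w => h (X2 w)).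
Proof.
move=> mE1 mE2 mX1 mX2 c0 PE hb.
rewrite (Cintegral_law_on mE1 mX1)// (Cintegral_law_on mE2 mX2)//.
rewrite -(Cintegral_scaled _ c0)//.
by congr (_ +i* _); congr fine; apply: eq_measure_integral => A mA _;
  exact: PE.
Qed.

End Transfer.

Section ProductLaw.
Context {R : realType} {d d1 d2 : measure_display} {T : measurableType d}.
Context {T1 : measurableType d1} {T2 : measurableType d2}.
Context (P : {finite_measure set T -> \bar R}).
Context (nu : {finite_measure set T2 -> \bar R}).
Context (E : set T) (mE : measurable E).
Context (X : T -> T1) (mX : measurable_fun setT X).
Context (Y : T -> T2) (mY : measurable_fun setT Y).
Hypothesis PXY : forall A B, measurable A -> measurable B ->
  P ((X @^-1` A `&` Y @^-1` B) `&` E) = (P (X @^-1` A `&` E) * nu B)%E.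

Lemma bounded_mfun_section (f : T1 * T2 -> R) x : bounded_mfun f ->
  bounded_mfun (fun y => f (x, y)).
Proof.
move=> [mf [M fM]]; split; last by exists M => y; exact: fM.
exact: (measurableT_comp mf (measurable_pair1 x)).
Qed.

Lemma bounded_mfun_integrable_product (f : T1 * T2 -> R) : bounded_mfun f ->
  (law_on P mE mX \x nu)%E.-integrable setT (EFin \o f).
Proof.
move=> [mf [M fM]]; apply: measurable_bounded_integrable => //.
- apply: (@le_lt_trans _ _ (law_on P mE mX setT * nu setT)%E).
    by rewrite -product_measure1E// setXTT.
  by rewrite -ge0_fin_numE ?mule_ge0// fin_numM// fin_num_measure.
- exists M; split; first exact: num_real.
  by move=> N MN x _ /=; apply: (le_trans (fM x)); exact: ltW.
Qed.

Lemma bounded_mfun_Rintegral_section (f : T1 * T2 -> R) : bounded_mfun f ->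
  bounded_mfun (fun x => Rintegral nu setT (fun y => f (x, y))).
Proof.
move=> bf; have [mf [M fM]] := bf; split.
  apply: measurableT_comp => //.
  apply: (@measurable_fubini_F _ _ _ _ _ (law_on P mE mX) nu (EFin \o f)).
  exact: bounded_mfun_integrable_product.
exists (M * fine (nu setT)) => x.
apply: (le_trans (le_normr_Rintegral _ _)) => //.
  by apply: bounded_mfun_integrable => //; exact: bounded_mfun_section.
rewrite -Rintegral_cst//; apply: le_Rintegral => //.
- apply: bounded_mfun_integrable => //.
  have [mg [N gN]] := bounded_mfun_section x bf.
  by split; [exact: measurableT_comp|exists N => y; rewrite normr_id].
- by apply: bounded_mfun_integrable => //; exact: bounded_mfun_cst.
Qed.

(** By [PXY] the law of (X, Y) on E agrees with a product measure on rectangles, hence everywhere.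
    After Fubini only X is left in the outer integral, which is then pulled back to E. *)
Lemma Rintegral_product_law (f : T1 * T2 -> R) : bounded_mfun f ->
  Rintegral P E (fun w => f (X w, Y w)) =
  Rintegral P E (fun w => Rintegral nu setT (fun y => f (X w, y))).
Proof.
move=> bf; have mXY : measurable_fun setT (fun w => (X w, Y w)).
  exact: measurable_fun_pair.
rewrite /Rintegral -(@integral_law_on _ _ _ _ _ _ _ mE _ mXY)//.
rewrite -(@integral_law_on _ _ _ _ _ _ _ mE _ mX _
  (bounded_mfun_Rintegral_section bf)).
congr fine.
rewrite (eq_measure_integral (law_on P mE mX \x nu)%E); last first.
  move=> C mC _; apply/esym.
  apply: (product_measure_unique (m' := law_on P mE mXY)) => //.
apply: (etrans (esym (integral12_prod_meas1 (bounded_mfun_integrable_product bf)))).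
apply: eq_integral => x _; rewrite /fubini_F /Rintegral fineK//.
apply: integrable_fin_num => //; apply: bounded_mfun_integrable => //.
exact: bounded_mfun_section.
Qed.

Lemma Cintegral_product_law (h : T1 * T2 -> R[i]) : bounded_cmfun h ->
  Cintegral P E (fun w => h (X w, Y w)) =
  Cintegral P E (fun w => Cintegral nu setT (fun y => h (X w, y))).
Proof.
move=> [rh ih]; apply: complexP.
  exact: (Rintegral_product_law rh).
exact: (Rintegral_product_law ih).
Qed.

End ProductLaw.

(** * The exponential law *)

Section Exponential.
Context {R : realType} (l : R) (l0 : 0 < l).
Local Notation mu := (@lebesgue_measure R).

(** The canonical instance is applied by hand because it depends on the proof [l0], which
    [exponential_prob l] does not mention. *)
Definition expo : probability (measurableTypeR R) R :=
  exponential_distribution_exponential_prob__canonical__probability_measure_Probability l0.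

Lemma expoE A : expo A = exponential_prob l A.
Proof. by []. Qed.

Lemma expo_dominates : expo `<< mu.
Proof.
apply/null_content_dominatesP => A mA muA0; rewrite expoE /exponential_prob.
rewrite (negligible_integral mA mA)//; first by rewrite setDv integral_set0.
by apply: integrableS (integrable_exponential_pdf l0).
Qed.

Lemma integral_expo D (f : R -> R) : measurable D -> bounded_mfun f ->
  (\int[expo]_(x in D) (f x)%:E =
   \int[mu]_(x in D) ((f x)%:E * (exponential_pdf l x)%:E))%E.
Proof.
move=> mD bf; have mf : measurable_fun setT (EFin \o f).
  by apply/measurable_EFinP; exact: bf.1.
have mfD : measurable_fun D (EFin \o f) by exact: measurable_funTS.
have mp : measurable_fun D (EFin \o exponential_pdf l).
  by apply/measurable_funTS/measurable_EFinP; exact: measurable_exponential_pdf.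
rewrite -(Radon_Nikodym_change_of_variables expo_dominates mD)//; last first.
  exact: bounded_mfun_integrable.
apply: ae_eq_integral => //.
- apply: emeasurable_funM => //; apply: (measurable_int mu).
  apply: (integrableS _ _ (@subsetT _ _)) => //=.
  by apply: Radon_Nikodym_integrable; exact: expo_dominates.
- exact: emeasurable_funM.
(* The Radon-Nikodym derivative and the density have the same integral over every measurable set, so
   they agree almost everywhere. *)
- apply: ae_eqe_mul2l => /=.
  rewrite Radon_NikodymE//=; first exact: expo_dominates.
  move=> dom; case: cid => /= h [h1 h2 h3].
  apply: integral_ae_eq => //=; first exact: integrableS h2.
  by move=> E ED mE; rewrite -h3.
Qed.

Lemma expo_ray x : expo `]-oo, x]%classic =
  (if 0 <= x then 1 - expR (- (l * x)) else 0)%:E.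
Proof.
rewrite expoE /exponential_prob.
have pdf_neg (A : set R) : measurable A -> (forall y, A y -> y < 0) ->
    (\int[mu]_(y in A) (exponential_pdf l y)%:E = 0)%E.
  move=> mA A0; apply: integral0_eq => y Ay.
  by rewrite lt0_exponential_pdf// A0.
case: ifPn => [x0|]; last first.
  rewrite -ltNge => x0; apply: pdf_neg => // y; rewrite /= in_itv/= => yx.
  exact: le_lt_trans x0.
rewrite (@itv_bndbnd_setU _ _ _ (BLeft 0))// integral_setU_EFin//=; last 2 first.
- by apply: measurable_funTS; exact: measurable_exponential_pdf.
- apply/disj_setPS => y [/=]; rewrite !in_itv/= => y0 /andP[].
  by rewrite leNgt y0.
rewrite pdf_neg; [|by []|by move=> y; rewrite /= in_itv].
rewrite add0e; have [->|xN0] := eqVneq x 0.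
  by rewrite set_itv1 integral_set1 mulr0 oppr0 expR0 subrr.
have := @exponential_prob_itv0c R l x; rewrite /exponential_prob => ->.
  by rewrite EFinB mulNr.
by rewrite lt_neqAle eq_sym xN0.
Qed.

End Exponential.

(** * Integrals of complex exponentials over compact intervals *)

Section CexpIntegral.
Context {R : realType}.
Local Notation mu := (@lebesgue_measure R).

(** The free factor [c] makes real parts sufficient: Im w is the real part of -i w, so imaginary
    parts are the case of the factor -i c. *)
Lemma is_derive_cexp_Re (c z : R[i]) (t : R) :
  is_derive t 1 (fun t : R => Re (c * cexp (z * t%:C)))
    (Re (c * z * cexp (z * t%:C))).
Proof.
case: c z => [a b] [x y] /=.
have H : is_derive t 1 (fun t : R => a * (expR (x * t) * cos (y * t)) -
                                      b * (expR (x * t) * sin (y * t)))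
  ((a * x - b * y) * (expR (x * t) * cos (y * t)) -
   (a * y + b * x) * (expR (x * t) * sin (y * t))).
  by apply: is_derive_eq; rewrite /GRing.scale /=; ring.
have e (u : R) : (x * u - y * 0 = x * u) * (x * 0 + y * u = y * u).
  by rewrite !mulr0 subr0 add0r.
under eq_fun do rewrite !e.
by rewrite !e.
Qed.

Lemma continuous_cexp_Re (c z : R[i]) :
  continuous (fun t : R => Re (c * cexp (z * t%:C))).
Proof.
move=> t; apply/differentiable_continuous/derivable1_diffP.
by have [] := is_derive_cexp_Re c z t.
Qed.

Lemma Rintegral_cexp_Re (c z : R[i]) (a b : R) : a <= b ->
  Rintegral mu `[a, b] (fun t => Re (c * z * cexp (z * t%:C))) =
  Re (c * cexp (z * b%:C)) - Re (c * cexp (z * a%:C)).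
Proof.
rewrite le_eqVlt => /predU1P[<-|ab]; first by rewrite set_itv1 Rintegral_set1 subrr.
rewrite /Rintegral.
rewrite (@continuous_FTC2 _ _ (fun t : R => Re (c * cexp (z * t%:C))))//.
- by apply: continuous_subspaceT; exact: continuous_cexp_Re.
- have cF : continuous (fun t : R => Re (c * cexp (z * t%:C))).
    exact: continuous_cexp_Re.
  split; first by move=> t _; have [] := is_derive_cexp_Re c z t.
  + by apply/cvg_at_right_filter; exact: cF.
  + by apply/cvg_at_left_filter; exact: cF.
- by move=> t _; rewrite derive1E; have [_ ->] := is_derive_cexp_Re c z t.
Qed.

(** With the factor z in the integrand there is no division by z. The value z = 0 is thus included;
    it occurs below as z = s - l. *)
Lemma Cintegral_cexp (c z : R[i]) (a b : R) : a <= b ->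
  Cintegral mu `[a, b] (fun t => c * z * cexp (z * t%:C)) =
  c * cexp (z * b%:C) - c * cexp (z * a%:C).
Proof.
move=> ab; apply: complexP; rewrite /Cintegral.
  by rewrite [LHS]Rintegral_cexp_Re// ReD ReN.
have ImE (w : R[i]) : Im w = Re ((- 'i) * w).
  by case: w => u v /=; ring.
rewrite [LHS](_ : _ = Rintegral mu `[a, b]
    (fun t => Re ((- 'i) * c * z * cexp (z * t%:C)))); last first.
  by apply: eq_Rintegral => t _; rewrite ImE !mulrA.
by rewrite Rintegral_cexp_Re// ImE mulrBr ReD ReN !mulrA.
Qed.

End CexpIntegral.

Section ComplexExponential.
Context {R : realType}.
Implicit Types (s z : R[i]) (r x : R).

Lemma cexp_real r : cexp r%:C = (expR r)%:C.
Proof. by apply: complexP; rewrite /= ?cos0 ?sin0 ?mulr1 ?mulr0. Qed.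

Lemma ler_Re_cexp z : `|Re (cexp z)| <= expR (Re z).
Proof.
rewrite /= normrM ger0_norm ?expR_ge0//.
by rewrite ler_piMr ?expR_ge0// cos_max.
Qed.

Lemma ler_Im_cexp z : `|Im (cexp z)| <= expR (Re z).
Proof.
rewrite /= normrM ger0_norm ?expR_ge0//.
by rewrite ler_piMr ?expR_ge0// sin_max.
Qed.

(* The maximum with 0 is the positive part in the recursion for W_n; where the
   argument is nonnegative anyway, it only keeps the function bounded. *)
Lemma bounded_cmfun_decay s : 0 <= Re s ->
  bounded_cmfun (fun r : R => cexp (- s * (Num.max r 0)%:C)).
Proof.
move=> s0.
have ReE r : Re (- s * (Num.max r 0)%:C) = - Re s * Num.max r 0.
  by rewrite !ReIm /= mulr0 subr0.
have ImE r : Im (- s * (Num.max r 0)%:C) = - Im s * Num.max r 0.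
  by rewrite !ReIm /= mulr0 add0r.
have le1 r : expR (Re (- s * (Num.max r 0)%:C)) <= 1.
  by rewrite ReE expR_le1 mulNr oppr_le0 mulr_ge0// le_max lexx orbT.
have mM (a : R) : measurable_fun setT (fun r : R => a * Num.max r 0).
  apply: measurable_funM => //.
  exact: measurable_maxr.
split; split.
- rewrite /cexp /=; under eq_fun do rewrite ReE ImE.
  apply: measurable_funM; first exact: measurableT_comp.
  apply: measurableT_comp; last exact: mM.
  by apply: continuous_measurable_fun; exact: continuous_cos.
- by exists 1 => r; apply: (le_trans (ler_Re_cexp _)).
- rewrite /cexp /=; under eq_fun do rewrite ReE ImE.
  apply: measurable_funM; first exact: measurableT_comp.
  apply: measurableT_comp; last exact: mM.
  by apply: continuous_measurable_fun; exact: continuous_sin.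
- by exists 1 => r; apply: (le_trans (ler_Im_cexp _)).
Qed.

Lemma cexpMB (a b : R[i]) (x t : R) :
  cexp (a * (x - t)%:C) = cexp (a * x%:C) * cexp (- a * t%:C).
Proof.
by rewrite -cexpD; congr cexp; apply: complexP; rewrite !ReIm /=; ring.
Qed.

End ComplexExponential.

Section ExpoIntegral.
Context {R : realType} (l : R) (l0 : 0 < l).
Local Notation mu := (@lebesgue_measure R).

Lemma expo_set1 x : expo l0 [set x] = 0%E.
Proof.
have /null_content_dominatesP := expo_dominates l0; apply => //.
exact: lebesgue_measure_set1.
Qed.

Lemma expo_lray x : 0 <= x -> expo l0 `]-oo, x[%classic = (1 - expR (- (l * x)))%:E.
Proof.
move=> x0; have := expo_ray l0 x; rewrite x0 => <-.
rewrite -[in RHS](@setUitv1 _ _ _ x true)//.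
rewrite measureU//; first by rewrite [X in (_ + X)%E]expo_set1 adde0.
by apply/seteqP; split => // y [/=]; rewrite in_itv/= => + yx; rewrite yx ltxx.
Qed.

Lemma expo_rray x : 0 <= x -> expo l0 `]x, +oo[%classic = (expR (- (l * x)))%:E.
Proof.
move=> x0; rewrite -setCitvl probability_setC// expo_ray x0 -EFinB.
by congr EFin; ring.
Qed.

Lemma Cintegral_expo_itv (f : R -> R[i]) a b : bounded_cmfun f -> 0 <= a ->
  Cintegral (expo l0) `[a, b] f =
  Cintegral mu `[a, b] (fun t => l%:C * cexp (- l%:C * t%:C) * f t).
Proof.
move=> [rf fi] a0; have H (g : R -> R) : bounded_mfun g ->
    Rintegral (expo l0) `[a, b] g =
    Rintegral mu `[a, b] (fun t => l * expR (- (l * t)) * g t).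
  move=> bg; rewrite /Rintegral integral_expo//; congr fine.
  apply: eq_integral => t; rewrite inE /= in_itv/= => /andP[at_ _].
  rewrite exponential_pdfE ?(le_trans a0)// -EFinM mulrC; congr (_ * _)%:E.
  by rewrite mulNr.
have E t : l%:C * cexp (- l%:C * t%:C) = (l * expR (- (l * t)))%:C.
  have -> : - l%:C * t%:C = (- (l * t))%:C.
    by apply: complexP; rewrite !ReIm /=; ring.
  by rewrite cexp_real; apply: complexP; rewrite !ReIm /=; ring.
apply: complexP; rewrite [LHS]H//; apply: eq_Rintegral => t _.
  by rewrite E ReM /= mul0r subr0.
by rewrite E ImM /= mul0r addr0.
Qed.

End ExpoIntegral.

Section ExpoTransform.
Context {R : realType} (l : R) (l0 : 0 < l).
Local Notation mu := (@lebesgue_measure R).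

(** The cuts separate the ranges where the positive part is 0, and the integrand constant, from a
    compact interval on which the integrand is an exponential. *)
Lemma Cintegral_expo_pieces (f : R -> R[i]) a b :
  bounded_cmfun f -> 0 <= a -> a <= b ->
  Cintegral (expo l0) setT f =
  Cintegral (expo l0) `]-oo, a[ f + Cintegral (expo l0) `[a, b] f +
  Cintegral (expo l0) `]b, +oo[ f.
Proof.
move=> cf a0 ab.
have -> : setT = `]-oo, a[%classic `|` `[a, b]%classic `|` `]b, +oo[%classic.
  apply/esym; rewrite -subTset => y _ /=; rewrite !in_itv/= andbT.
  by have [yb|by_] := leP y b; [have [ay|ya] := leP a y; left; [right|left]|right].
rewrite !Cintegral_setU//.
- by apply/disj_setPS => y [/=]; rewrite !in_itv/= => ya; rewrite leNgt ya.
- exact: measurableU.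
- apply/disj_setPS => y [/= + ]; rewrite !in_itv/= andbT => -[ya|/andP[_ yb]] b_y.
    by have := lt_le_trans (lt_trans b_y ya) ab; rewrite ltxx.
  by have := lt_le_trans b_y yb; rewrite ltxx.
Qed.

Lemma Cintegral_expo_rray_cst c x : 0 <= x ->
  Cintegral (expo l0) `]x, +oo[ (fun=> c) = c * (expR (- (l * x)))%:C.
Proof.
move=> x0; rewrite Cintegral_cst//; congr (_ * _%:C).
exact: (congr1 fine (expo_rray l0 x0)).
Qed.

Lemma Cintegral_expo_lray_cst c x : 0 <= x ->
  Cintegral (expo l0) `]-oo, x[ (fun=> c) = c * (1 - expR (- (l * x)))%:C.
Proof.
move=> x0; rewrite Cintegral_cst//; congr (_ * _%:C).
exact: (congr1 fine (expo_lray l0 x0)).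
Qed.

(** Put under the integral, s - l turns the integrand on [0, x] into the derivative of l e^{-s x}
    e^{(s - l) a}. Beyond x the positive part is 0, which contributes (s - l) e^{-l x}; below 0
    there is no mass. *)
Lemma expo_transform_under (s : R[i]) (x : R) : 0 <= Re s -> 0 <= x ->
  (s - l%:C) * Cintegral (expo l0) setT
     (fun a => cexp (- s * (Num.max (x - a) 0)%:C)) =
  s * cexp (- l%:C * x%:C) - l%:C * cexp (- s * x%:C).
Proof.
move=> s0 x0.
have cf : bounded_cmfun (fun a : R => cexp (- s * (Num.max (x - a) 0)%:C)).
  have mu_meas : measurable_fun setT (fun a : R => x - a) by exact: measurable_funB.
  exact: (bounded_cmfun_comp mu_meas (bounded_cmfun_decay s0)).
have cf' := bounded_cmfunM (bounded_cmfun_cst (s - l%:C)) cf.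
rewrite -CintegralZl// (@Cintegral_expo_pieces _ 0 x)//.
rewrite Cintegral_null//; last first.
  by apply: etrans (expo_lray l0 (lexx 0)) _; rewrite mulr0 oppr0 expR0 subrr.
rewrite add0r Cintegral_expo_itv//.
rewrite (@eq_Cintegral _ _ (measurableTypeR R) _ `]x, +oo[%classic _
  (fun=> s - l%:C)); last first.
  move=> a; rewrite /= in_itv/= andbT => xa.
  rewrite max_r ?subr_le0 ?ltW// -[RHS]mulr1; congr (_ * _).
  by rewrite -[RHS]cexp0; congr cexp; rewrite mulr0.
rewrite Cintegral_expo_rray_cst//.
rewrite (@eq_Cintegral _ _ (measurableTypeR R) _ `[0, x]%classic _
  (fun t => (l%:C * cexp (- s * x%:C)) * (s - l%:C) *
            cexp ((s - l%:C) * t%:C))); last first.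
  move=> a; rewrite /= in_itv/= => /andP[a0 ax].
  rewrite max_l ?subr_ge0// cexpMB//.
  have -> : (s - l%:C) * a%:C = - l%:C * a%:C + - - s * a%:C by ring.
  rewrite cexpD; ring.
rewrite Cintegral_cexp//.
have -> : (s - l%:C) * 0%:C = 0 by rewrite mulr0.
have -> : (s - l%:C) * x%:C = - l%:C * x%:C + - - s * x%:C by ring.
rewrite cexp0 cexpD mulr1 -cexp_real.
have -> : (- (l * x))%:C = - l%:C * x%:C :> R[i].
  by apply: complexP; rewrite !ReIm /=; ring.
have e : cexp (- s * x%:C) * cexp (- - s * x%:C) = 1.
  by rewrite -cexpD -[RHS]cexp0; congr cexp; ring.
transitivity (l%:C * cexp (- l%:C * x%:C) *
  (cexp (- s * x%:C) * cexp (- - s * x%:C)) - l%:C * cexp (- s * x%:C) +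
  (s - l%:C) * cexp (- l%:C * x%:C)); first ring.
rewrite e; ring.
Qed.

(** Takes the place of letting y tend to infinity: a constant bounded by a decaying exponential
    vanishes. *)
Lemma decay_eq0 (r K x : R) : 0 <= x ->
  (forall y, x <= y -> `|r| <= K * expR (- (l * y))) -> r = 0.
Proof.
move=> x0 rK; apply/eqP; rewrite -normr_eq0; apply: contraT => rN0.
have r0 : 0 < `|r| by rewrite lt_neqAle eq_sym rN0 normr_ge0.
have K0 : 0 <= K.
  have := le_trans (normr_ge0 _) (rK x (lexx x)).
  by rewrite pmulr_lge0// expR_gt0.
(* Chosen so that |r| l y >= K + 1, whereas the bound at y together with e^{l y} >= 1 + l y gives
   |r| l y <= K. *)
pose y := x + (K + 1) / (`|r| * l).
have xy : x <= y by rewrite lerDl divr_ge0 ?addr_ge0// mulr_ge0// ltW.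
have ry : `|r| * (l * y) <= K.
  have := rK _ xy; rewrite expRN ler_pdivlMr ?expR_gt0//; apply: le_trans.
  rewrite ler_wpM2l//; apply: le_trans (expR_ge1Dx _).
  by rewrite lerDr.
have : `|r| * (l * y) = `|r| * l * x + (K + 1).
  rewrite /y; field; rewrite normr_eq0 in rN0 *.
  by rewrite rN0 gt_eqF.
have : 0 <= `|r| * l * x by rewrite !mulr_ge0// ltW.
lra.
Qed.

Lemma ler_Rintegral_expo_rray (f : R -> R) M y : bounded_mfun f -> 0 <= y ->
  (forall a, `|f a| <= M) ->
  `|Rintegral (expo l0) `]y, +oo[ f| <= M * expR (- (l * y)).
Proof.
move=> bf y0 fM; apply: (le_trans (le_normr_Rintegral _ _)) => //.
  exact: bounded_mfun_integrable.
have -> : M * expR (- (l * y)) =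
    Rintegral (expo l0) `]y, +oo[ (fun=> M).
  rewrite Rintegral_cst//; congr (_ * _).
  exact: (esym (congr1 fine (expo_rray l0 y0))).
have [mf _] := bf; apply: le_Rintegral => //.
- apply: bounded_mfun_integrable => //; split; first exact: measurableT_comp.
  by exists M => a; rewrite normr_id.
- by apply: bounded_mfun_integrable => //; exact: bounded_mfun_cst.
Qed.

(** The positive part now lives on the unbounded interval beyond x, while the antiderivative is
    available on compact intervals. The integral is therefore cut at an arbitrary y >= x, and the
    difference [D] of the two sides is estimated as y grows. *)
Lemma expo_transform_over (s : R[i]) (x : R) : 0 <= Re s -> 0 <= x ->
  (s + l%:C) * Cintegral (expo l0) setT
     (fun a => cexp (- s * (Num.max (a - x) 0)%:C)) =
  s + l%:C - s * cexp (- l%:C * x%:C).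
Proof.
move=> s0 x0; set f := fun a : R => _.
have cf : bounded_cmfun f.
  have mu_meas : measurable_fun setT (fun a : R => a - x) by exact: measurable_funB.
  exact: (bounded_cmfun_comp mu_meas (bounded_cmfun_decay s0)).
have cf' := bounded_cmfunM (bounded_cmfun_cst (s + l%:C)) cf.
rewrite -CintegralZl//; apply/eqP; rewrite -subr_eq0; apply/eqP.
set D := (X in X = 0).
(* The mass below x and the antiderivative at x add up to the right-hand side of the lemma; the
   antiderivative at y and the tail survive. *)
have DE y : x <= y -> D = - (l%:C * cexp (s * (x - y)%:C - l%:C * y%:C)) +
   Cintegral (expo l0) `]y, +oo[ (fun a => (s + l%:C) * f a).
  move=> xy; rewrite /D (@Cintegral_expo_pieces _ x y)//.
  rewrite Cintegral_expo_itv//.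
  rewrite (@eq_Cintegral _ _ (measurableTypeR R) _ `]-oo, x[%classic _
    (fun=> s + l%:C)); last first.
    move=> a; rewrite /= in_itv/= => ax.
    rewrite /f max_r ?subr_le0 ?ltW// -[RHS]mulr1; congr (_ * _).
    by rewrite -[RHS]cexp0; congr cexp; rewrite mulr0.
  rewrite Cintegral_expo_lray_cst//.
  rewrite (@eq_Cintegral _ _ (measurableTypeR R) _ `[x, y]%classic _ (fun t =>
     (- l%:C * cexp (s * x%:C)) *
     (- (s + l%:C)) * cexp ((- (s + l%:C)) * t%:C))); last first.
    move=> a; rewrite /= in_itv/= => /andP[xa ay].
    rewrite /f max_l ?subr_ge0//.
    have -> : - s * (a - x)%:C = s * x%:C + - s * a%:C.
      by apply: complexP; rewrite !ReIm /=; ring.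
    have -> : - (s + l%:C) * a%:C = - l%:C * a%:C + - s * a%:C by ring.
    rewrite !cexpD; ring.
  rewrite Cintegral_cexp//.
  have -> : (1 - expR (- (l * x)))%:C = 1 - cexp (- l%:C * x%:C).
    rewrite (_ : - l%:C * x%:C = (- (l * x))%:C).
      by rewrite cexp_real; apply: complexP; rewrite !ReIm /=; ring.
    by apply: complexP; rewrite !ReIm /=; ring.
  have -> : s * (x - y)%:C - l%:C * y%:C = s * x%:C + - (s + l%:C) * y%:C.
    by apply: complexP; rewrite !ReIm /=; ring.
  have -> : - (s + l%:C) * x%:C = - l%:C * x%:C + - s * x%:C by ring.
  rewrite !cexpD.
  have e : cexp (s * x%:C) * cexp (- s * x%:C) = 1.
    by rewrite -cexpD -[RHS]cexp0; congr cexp; ring.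
  set I := (X in _ = _ + X); rewrite [X in _ + X - _](_ : _ = I)//.
  transitivity ((s + l%:C) * (1 - cexp (- l%:C * x%:C)) +
    (- l%:C * cexp (s * x%:C) * cexp (- (s + l%:C) * y%:C) + l%:C *
      (cexp (s * x%:C) * cexp (- s * x%:C)) * cexp (- l%:C * x%:C)) + I -
    (s + l%:C - s * cexp (- l%:C * x%:C))); first ring.
  rewrite e; ring.
(* All terms of [DE y] are O(e^{-l y}), while [D] does not depend on y. *)
have [br bi] := cf'; have [_ [M1 rM]] := br; have [_ [M2 iM]] := bi.
have le y : x <= y -> expR (Re (s * (x - y)%:C - l%:C * y%:C)) <= expR (- (l * y)).
  move=> xy; rewrite ler_expR !ReIm /= !mul0r !mulr0 !subr0.
  by rewrite gerDr mulr_ge0_le0// subr_le0.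
apply: complexP.
- apply: (@decay_eq0 _ (l + M1) x) => // y xy.
  rewrite (DE _ xy) ReD mulrDl; apply: (le_trans (ler_normD _ _)); apply: lerD.
    rewrite ReN normrN ReM /= mul0r subr0 normrM gtr0_norm// ler_pM2l//.
    exact: le_trans (ler_Re_cexp _) (le _ xy).
  exact: (ler_Rintegral_expo_rray br (le_trans x0 xy) rM).
- apply: (@decay_eq0 _ (l + M2) x) => // y xy.
  rewrite (DE _ xy) ImD mulrDl; apply: (le_trans (ler_normD _ _)); apply: lerD.
    rewrite ImN normrN ImM /= mul0r addr0 normrM gtr0_norm// ler_pM2l//.
    exact: le_trans (ler_Im_cexp _) (le _ xy).
  exact: (ler_Rintegral_expo_rray bi (le_trans x0 xy) iM).
Qed.

End ExpoTransform.

(** * One step of the chain *)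

Section StieltjesMeasure.
Context {R : realType} (F : cumulativeBounded (0 : R) (1 : R)).
Local Notation nuF := (lebesgue_stieltjes_measure F).

Lemma stieltjes_ray y : nuF `]-oo, y]%classic = (F y)%:E.
Proof. exact: (cdf_lebesgue_stieltjes_id F y). Qed.

Hypothesis F0 : forall y, y < 0 -> F y = 0.

(** F may jump at 0, so the ray ending at 0 cannot be taken closed. The open one is the union of the
    closed rays up to -1/(n+1), on each of which F gives mass 0. *)
Lemma stieltjes_neg : nuF `]-oo, 0[%classic = 0%E.
Proof.
apply/eqP; rewrite eq_le measure_ge0 andbT.
have -> : `]-oo, (0 : R)[%classic = \bigcup_n `]-oo, (- n.+1%:R^-1 : R)]%classic.
  apply/seteqP; split => y /=.
    rewrite in_itv/= => y0; exists (Num.truncn (- y)^-1) => //=.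
    rewrite in_itv/= lerNr -[leRHS]invrK lef_pV2 ?posrE ?invr_gt0 ?oppr_gt0//.
    by rewrite ltW// truncnS_gt.
  move=> [n _]; rewrite /= !in_itv/= => /le_lt_trans; apply.
  by rewrite oppr_lt0 invr_gt0.
have nul n : nuF.-negligible `]-oo, (- n.+1%:R^-1 : R)]%classic.
  apply/negligibleP => //; apply: etrans (stieltjes_ray _) _.
  by rewrite F0// oppr_lt0 invr_gt0.
have /negligibleP -> // := negligible_bigcup nul.
exact: bigcupT_measurable.
Qed.

(** The untruncated exponential may be unbounded for t < 0. Truncation allows integration over the
    whole line, as the product law requires, and costs nothing because negative t carry no mass. *)
Lemma LST_decay (s : R[i]) : 0 <= Re s ->
  Cintegral nuF setT (fun t : R => cexp (- s * (Num.max t 0)%:C)) = LST F s.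
Proof.
move=> s0; rewrite /LST.
have -> : setT = `]-oo, (0 : R)[%classic `|` `[0, +oo[%classic.
  by rewrite -setCitvl setUv.
rewrite Cintegral_setU//; last 2 first.
- exact: bounded_cmfun_decay.
- by rewrite -setCitvl; exact/disj_setPCl.
rewrite Cintegral_null//; last 2 first.
- exact: stieltjes_neg.
- exact: bounded_cmfun_decay.
rewrite add0r; apply: eq_Cintegral => t; rewrite /= in_itv/= andbT => t0.
by rewrite max_l.
Qed.

End StieltjesMeasure.

(** * Joint law of workload, service time and exponential variable on a transition *)

Section JointLaw.
Context {R : realType} {d : measure_display} {T : measurableType d}.
Context (P : probability T R) (F : cumulativeBounded (0 : R) (1 : R)).
Context (l : R) (l0 : 0 < l) (c : R) (c0 : 0 <= c).
Context (E1 E2 : set T) (mE1 : measurable E1) (mE2 : measurable E2).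
Local Notation U := (measurableTypeR R).
Local Notation nuF := (lebesgue_stieltjes_measure F).
Context (W S A : T -> U) (mW : measurable_fun setT W).
Context (mS : measurable_fun setT S) (mA : measurable_fun setT A).
Hypothesis F0 : forall y, y < 0 -> F y = 0.
Hypothesis W0 : forall w, 0 <= W w.
Hypothesis S0 : forall w, 0 <= S w.
Hypothesis A0 : forall w, 0 <= A w.
Hypothesis joint_cdf : forall (G : set U) (x y : R), measurable G ->
  0 <= x -> 0 <= y ->
  P (W @^-1` G `&` S @^-1` `]-oo, y]%classic `&` A @^-1` `]-oo, x]%classic `&` E2)
  = (c * F y * (1 - expR (- (l * x))) * fine (P (W @^-1` G `&` E1)))%:E.

Let mpre (X : T -> U) (mX : measurable_fun setT X) (B : set U) :
  measurable B -> measurable (X @^-1` B).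
Proof. by move=> mB; rewrite -[X in measurable X]setTI; exact: mX. Qed.

(** In the application [E1] is {Z_n = i}, [E2] is {Z_n = i, Z_{n+1} = j}, [c] is p_ij, and the roles
    of [S] and [A] are also taken by C_n and D_{n+1}. Rays are replaced by Borel sets one coordinate
    at a time: with G and x fixed, both sides are finite measures in B. *)
Lemma joint_law_cdf (G B : set U) (x : R) : measurable G -> measurable B ->
  0 <= x ->
  P (W @^-1` G `&` S @^-1` B `&` A @^-1` `]-oo, x]%classic `&` E2)
  = (c * fine (nuF B) * (1 - expR (- (l * x))) * fine (P (W @^-1` G `&` E1)))%:E.
Proof.
move=> mG mB x0.
set q := fine (P (W @^-1` G `&` E1)).
have q0 : 0 <= q by rewrite fine_ge0.
have e0 : 0 <= 1 - expR (- (l * x)).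
  by rewrite subr_ge0 expR_le1 oppr_le0 mulr_ge0// ltW.
have k0 : 0 <= c * (1 - expR (- (l * x))) * q by rewrite !mulr_ge0.
have mH : measurable (W @^-1` G `&` A @^-1` `]-oo, x]%classic `&` E2).
  by apply: measurableI => //; apply: measurableI; exact: mpre.
have -> : W @^-1` G `&` S @^-1` B `&` A @^-1` `]-oo, x]%classic `&` E2 =
  S @^-1` B `&` (W @^-1` G `&` A @^-1` `]-oo, x]%classic `&` E2).
  by rewrite [W @^-1` _ `&` S @^-1` _]setIC -!setIA.
apply: (etrans (@finite_measure_eq_on_rays R (law_on P mH mS) (scaled nuF k0)
  _ B mB)).
  move=> y; apply: (@etrans _ _ (c * F y * (1 - expR (- (l * x))) * q)%:E).
    have [y0|y0] := leP 0 y.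
      rewrite -joint_cdf//; congr (P _).
      by rewrite [W @^-1` _ `&` S @^-1` _]setIC -!setIA.
    (* For y < 0, where [joint_cdf] says nothing, both sides vanish: F by its support, the event
       because S is nonnegative. *)
    rewrite F0// mulr0 !mul0r -[RHS](measure0 P); congr (P _).
    apply/seteqP; split => // w [/=]; rewrite in_itv/= => Sy _.
    by have := lt_le_trans (le_lt_trans Sy y0) (S0 w); rewrite ltxx.
  apply: esym; apply: (etrans (congr1 (fun z => _ * z)%E (stieltjes_ray F y))).
  rewrite -EFinM/=; congr EFin; ring.
have nuB : nuF B = (fine (nuF B))%:E by rewrite fineK// fin_num_measure.
apply: (etrans (congr1 (fun z => _ * z)%E nuB)).
rewrite -EFinM/=; congr EFin; ring.
Qed.

Lemma joint_law (G B K : set U) : measurable G -> measurable B ->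
  measurable K ->
  P (W @^-1` G `&` S @^-1` B `&` A @^-1` K `&` E2)
  = (c * fine (nuF B) * fine (expo l0 K) * fine (P (W @^-1` G `&` E1)))%:E.
Proof.
move=> mG mB mK.
set q := fine (P (W @^-1` G `&` E1)).
have q0 : 0 <= q by rewrite fine_ge0.
have k0 : 0 <= c * fine (nuF B) * q by rewrite !mulr_ge0// fine_ge0.
have mH : measurable (W @^-1` G `&` S @^-1` B `&` E2).
  by apply: measurableI => //; apply: measurableI; exact: mpre.
have -> : W @^-1` G `&` S @^-1` B `&` A @^-1` K `&` E2 =
  A @^-1` K `&` (W @^-1` G `&` S @^-1` B `&` E2).
  by rewrite [_ `&` A @^-1` _]setIC -!setIA.
apply: (etrans (@finite_measure_eq_on_rays R (law_on P mH mA)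
  (scaled (expo l0) k0) _ K mK)).
  move=> x; apply: esym.
  apply: (etrans (congr1 (fun z => _ * z)%E (expo_ray l0 x))) => /=.
  case: ifPn => [x0|].
    apply: (@etrans _ _ (c * fine (nuF B) * (1 - expR (- (l * x))) * q)%:E).
      rewrite -EFinM/=; congr EFin; ring.
    rewrite -joint_law_cdf//; congr (P _).
    by rewrite [_ `&` A @^-1` _]setIC -!setIA.
  rewrite -ltNge => x0; rewrite mule0 -[LHS](measure0 P); congr (P _).
  apply/seteqP; split => // w [/=]; rewrite in_itv/= => Ax _.
  by have := lt_le_trans (le_lt_trans Ax x0) (A0 w); rewrite ltxx.
have eK : expo l0 K = (fine (expo l0 K))%:E by rewrite fineK// fin_num_measure.
apply: (etrans (congr1 (fun z => _ * z)%E eK)).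
rewrite -EFinM/=; congr EFin; ring.
Qed.

(** Leaving the other two coordinates free in the joint law keeps only the transition probability
    c. *)
Lemma marginal_law (G : set U) : measurable G ->
  P (W @^-1` G `&` E2) = (c%:E * P (W @^-1` G `&` E1))%E.
Proof.
move=> mG; have := joint_law mG measurableT measurableT.
rewrite !preimage_setT !setIT => ->.
have -> : P (W @^-1` G `&` E1) = (fine (P (W @^-1` G `&` E1)))%:E.
  by rewrite fineK// fin_num_measure//; apply: measurableI => //; exact: mpre.
rewrite -EFinM; congr EFin.
have -> : fine (nuF setT) = 1 by rewrite probability_setT.
have -> : fine (expo l0 setT) = 1 by rewrite probability_setT.
ring.
Qed.

Lemma service_law (G B : set U) : measurable G -> measurable B ->
  P ((W @^-1` G `&` S @^-1` B) `&` E2) = (P (W @^-1` G `&` E2) * nuF B)%E.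
Proof.
move=> mG mB; have := joint_law mG mB measurableT.
rewrite !preimage_setT !setIT => ->.
rewrite marginal_law//.
have -> : P (W @^-1` G `&` E1) = (fine (P (W @^-1` G `&` E1)))%:E.
  by rewrite fineK// fin_num_measure//; apply: measurableI => //; exact: mpre.
have nuB : nuF B = (fine (nuF B))%:E by rewrite fineK// fin_num_measure.
rewrite [in RHS]nuB -!EFinM; congr EFin.
have -> : fine (expo l0 setT) = 1 by rewrite probability_setT.
ring.
Qed.

Let mWS : measurable_fun setT (fun w => (W w, S w)).
Proof. exact: measurable_fun_pair. Qed.

(** Has the shape of the hypothesis [PXY] with the pair (W, S) as first component, so that the
    exponential variable can be integrated out while W + S is held fixed. Rectangles in (W, S)
    determine both sides. *)
Lemma expo_law (Q : set (U * U)) (K : set U) : measurable Q -> measurable K ->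
  P (((fun w => (W w, S w)) @^-1` Q `&` A @^-1` K) `&` E2) =
  (P ((fun w => (W w, S w)) @^-1` Q `&` E2) * expo l0 K)%E.
Proof.
move=> mQ mK; have k0 : 0 <= fine (expo l0 K) by rewrite fine_ge0.
have mH : measurable (A @^-1` K `&` E2).
  by apply: measurableI => //; exact: mpre.
have eK : expo l0 K = (fine (expo l0 K))%:E by rewrite fineK// fin_num_measure.
rewrite -setIA eK muleC.
apply: (@finite_measure_eq_on_rectangles R _ _ U U (law_on P mH mWS)
  (scaled (law_on P mE2 mWS) k0)) mQ => G B mG mB.
have := joint_law mG mB mK; rewrite -setIA => e.
apply: (etrans e).
apply: esym; have := service_law mG mB; rewrite marginal_law// => e'.
apply: (etrans (congr1 (fun z => _ * z)%E e')) => /=.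
have -> : P (W @^-1` G `&` E1) = (fine (P (W @^-1` G `&` E1)))%:E.
  by rewrite fineK// fin_num_measure//; apply: measurableI => //; exact: mpre.
have nuB : nuF B = (fine (nuF B))%:E by rewrite fineK// fin_num_measure.
rewrite [in LHS]nuB -!EFinM; congr EFin; ring.
Qed.

Let decay (s : R[i]) (r : R) : R[i] := cexp (- s * (Num.max r 0)%:C).

Lemma sum_transform (s : R[i]) : 0 <= Re s ->
  Cintegral P E2 (fun w => cexp (- s * (W w + S w)%:C)) =
  c%:C * LST F s * Cintegral P E1 (fun w => cexp (- s * (W w)%:C)).
Proof.
move=> s0; have cd : bounded_cmfun (decay s) by exact: bounded_cmfun_decay.
have cdU : bounded_cmfun (decay s : U -> R[i]) by exact: cd.
pose h (x : U * U) := decay s x.1 * decay s x.2.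
have ch : bounded_cmfun h.
  apply: bounded_cmfunM; [exact: (bounded_cmfun_comp measurable_fst cdU)|
                exact: (bounded_cmfun_comp measurable_snd cdU)].
have -> : Cintegral P E2 (fun w => cexp (- s * (W w + S w)%:C)) =
          Cintegral P E2 (fun w => h (W w, S w)).
  apply: eq_Cintegral => w _; rewrite /h /decay /= !max_l// -cexpD.
  by congr cexp; apply: complexP; rewrite !ReIm /=; ring.
rewrite (@Cintegral_product_law _ _ _ _ _ U U P nuF E2 mE2 W mW S mS service_law)//.
have -> : Cintegral P E2 (fun w => Cintegral nuF setT (fun y => h (W w, y))) =
          Cintegral P E2 (fun w => LST F s * decay s (W w)).
  apply: eq_Cintegral => w _; rewrite /h/= CintegralZl//.
  by rewrite mulrC LST_decay.
rewrite CintegralZl//; last exact: (bounded_cmfun_comp mW cdU).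
rewrite (Cintegral_proportional mE2 mE1 mW mW c0 marginal_law cdU).
rewrite mulrCA mulrA; congr (_ * _).
by apply: eq_Cintegral => w _; rewrite /decay max_l.
Qed.

Lemma bounded_cmfun_expo_section (h : (U * U) * U -> R[i]) : bounded_cmfun h ->
  bounded_cmfun (fun w => Cintegral (expo l0) setT (fun a => h ((W w, S w), a))).
Proof.
move=> [rh ih].
have H (f : (U * U) * U -> R) : bounded_mfun f ->
    bounded_mfun (fun w => Rintegral (expo l0) setT (fun a => f ((W w, S w), a))).
  move=> bf.
  have [mg [M gM]] := bounded_mfun_Rintegral_section P (expo l0) mE2 mWS bf.
  by split; [exact: (measurableT_comp mg mWS)|exists M => w; exact: gM].
by split; [exact: (H _ rh)|exact: (H _ ih)].
Qed.

Let real0 : 0 <= Re (l%:C : R[i]).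
Proof. exact: ltW. Qed.

Let bounded_cmfun_sum (s : R[i]) : 0 <= Re s ->
  bounded_cmfun (fun w => cexp (- s * (W w + S w)%:C)).
Proof.
move=> s0; have mD : measurable_fun setT (fun w => W w + S w : R).
  exact: measurable_funD.
have := bounded_cmfun_comp mD (bounded_cmfun_decay s0).
congr bounded_cmfun; apply/funext => w /=.
by rewrite max_l// addr_ge0.
Qed.

(** Integrating out A leaves exponentials of W + S with the parameters l and s; [sum_transform]
    evaluates each of them. *)
Lemma transform_under (s : R[i]) : 0 <= Re s ->
  (s - l%:C) * Cintegral P E2
    (fun w => cexp (- s * (Num.max (W w + S w - A w) 0)%:C)) =
  c%:C * (s * LST F l%:C * Cintegral P E1 (fun w => cexp (- l%:C * (W w)%:C)) -
   l%:C * LST F s * Cintegral P E1 (fun w => cexp (- s * (W w)%:C))).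
Proof.
move=> s0; pose h (x : (U * U) * U) := decay s (x.1.1 + x.1.2 - x.2).
have ch : bounded_cmfun h.
  have mu : measurable_fun setT
      (fun x : (U * U) * U => x.1.1 + x.1.2 - x.2 : R).
    apply: measurable_funB; last exact: measurable_snd.
    apply: measurable_funD; apply: measurableT_comp => //.
  exact: (bounded_cmfun_comp mu (bounded_cmfun_decay s0)).
rewrite [X in _ * X](@Cintegral_product_law _ _ _ _ _ (U * U)%type U P (expo l0)
  E2 mE2 _ mWS A mA expo_law h ch).
rewrite -(CintegralZl _ _ mE2 (bounded_cmfun_expo_section ch)).
rewrite (@eq_Cintegral _ _ _ P E2 _ (fun w => s * cexp (- l%:C * (W w + S w)%:C)
   - l%:C * cexp (- s * (W w + S w)%:C))); last first.
  move=> w _; exact: (expo_transform_under l0 s0 (addr_ge0 (W0 w) (S0 w))).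
rewrite CintegralB//; last 2 first.
- by apply: bounded_cmfunM; [exact: bounded_cmfun_cst|exact: bounded_cmfun_sum].
- by apply: bounded_cmfunM; [exact: bounded_cmfun_cst|exact: bounded_cmfun_sum].
rewrite !CintegralZl//; try exact: bounded_cmfun_sum.
rewrite !sum_transform//; ring.
Qed.

Lemma transform_over (s : R[i]) : 0 <= Re s ->
  (s + l%:C) * Cintegral P E2
    (fun w => cexp (- s * (Num.max (A w - (W w + S w)) 0)%:C)) =
  c%:C * ((s + l%:C) * (fine (P E1))%:C -
   s * LST F l%:C * Cintegral P E1 (fun w => cexp (- l%:C * (W w)%:C))).
Proof.
move=> s0; pose h (x : (U * U) * U) := decay s (x.2 - (x.1.1 + x.1.2)).
have ch : bounded_cmfun h.
  have mu : measurable_fun setT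
      (fun x : (U * U) * U => x.2 - (x.1.1 + x.1.2) : R).
    apply: measurable_funB; first exact: measurable_snd.
    apply: measurable_funD; apply: measurableT_comp => //.
  exact: (bounded_cmfun_comp mu (bounded_cmfun_decay s0)).
rewrite [X in _ * X](@Cintegral_product_law _ _ _ _ _ (U * U)%type U P (expo l0)
  E2 mE2 _ mWS A mA expo_law h ch).
rewrite -(CintegralZl _ _ mE2 (bounded_cmfun_expo_section ch)).
rewrite (@eq_Cintegral _ _ _ P E2 _ (fun w => s + l%:C -
   s * cexp (- l%:C * (W w + S w)%:C))); last first.
  move=> w _; exact: (expo_transform_over l0 s0 (addr_ge0 (W0 w) (S0 w))).
rewrite CintegralB//; last 2 first.
- exact: bounded_cmfun_cst.
- by apply: bounded_cmfunM; [exact: bounded_cmfun_cst|exact: bounded_cmfun_sum].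
rewrite CintegralZl//; last exact: bounded_cmfun_sum.
rewrite sum_transform// Cintegral_cst//.
have -> : fine (P E2) = c * fine (P E1).
  have := marginal_law measurableT; rewrite preimage_setT !setTI => ->.
  by rewrite fineM// fin_num_measure.
have -> : (c * fine (P E1))%:C = c%:C * (fine (P E1))%:C :> R[i].
  by apply: complexP; rewrite !ReIm /=; ring.
ring.
Qed.

End JointLaw.

Lemma sigma_algebraI {T : pointedType} (G : set (set T)) A B :
  <<s G >> A -> <<s G >> B -> <<s G >> (A `&` B).
Proof. exact: (@measurableI _ (g_sigma_algebraType G)). Qed.

Lemma events_preimage {R : realType} {d} {T : measurableType d} (X : T -> R)
  (B : set R) : measurable B -> events X (X @^-1` B).
Proof. by move=> mB; exists B => //; rewrite setTI. Qed.

Lemma state_events_preimage {d} {T : measurableType d} {N : nat}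
  (X : T -> 'I_N) (B : set 'I_N) :
  state_events X (X @^-1` B).
Proof. by exists B => //; rewrite setTI. Qed.

(** * Recursion for the transforms of the model *)

Section ModelStep.
Context {R : realType} {d : measure_display} {T : measurableType d}.
Context (P : probability T R) {N : nat}.
Context (p : R) (Pm : 'M[R]_N) (lam mu : 'I_N -> R).
Context (FB FC : 'I_N -> cumulativeBounded (0 : R) (1 : R)).
Context (Z : nat -> T -> 'I_N).
Context (W V S A C D : nat -> {RV P >-> R}).
Context (Y : nat -> R -> T -> R).
Hypothesis M : modelII p Pm lam mu FB FC Z W V S A C D Y.

Local Notation at_ n i := (Z n @^-1` [set i]).

Let mZ n i : measurable (at_ n i). Proof. exact: (Z_measurable M). Qed.

(** Conditional independence is used with the past event {W_n in G}. Multiplying by P(Z_n = i) gives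
    an identity that also holds when this probability is 0, both sides being 0 then; it is the
    hypothesis [joint_cdf] above. *)
Lemma modulated_cdf (F : 'I_N -> cumulativeBounded (0 : R) (1 : R))
    (rho : 'I_N -> R) (X X' : {RV P >-> R}) (n : nat) (i j : 'I_N) :
  modulated_pair Pm Z W V S A C D F rho X X' n ->
  forall (G : set R) (x y : R), measurable G -> 0 <= x -> 0 <= y ->
  P (W n @^-1` G `&` X' @^-1` `]-oo, y]%classic `&` X @^-1` `]-oo, x]%classic
     `&` (at_ n i `&` at_ n.+1 j))
  = (Pm i j * F i y * (1 - expR (- (rho j * x))) *
     fine (P (W n @^-1` G `&` at_ n i)))%:E.
Proof.
move=> mp G x y mG x0 y0.
have mWG : measurable (W n @^-1` G) by exact: measurable_funPTI.
have mX : measurable (X @^-1` `]-oo, x]%classic) by exact: measurable_funPTI.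
have mX' : measurable (X' @^-1` `]-oo, y]%classic) by exact: measurable_funPTI.
set lhs := (X in P X); set e := [set w | [/\ X w <= x, X' w <= y & Z n.+1 w = j]].
have eE : e =
    X @^-1` `]-oo, x]%classic `&` X' @^-1` `]-oo, y]%classic `&` at_ n.+1 j.
  apply/seteqP; split => w; rewrite /e /= !in_itv/=; first by move=> [? ? ?].
  by move=> [[? ?] ?].
have -> : lhs = (e `&` W n @^-1` G) `&` at_ n i.
  apply/seteqP; split => w; rewrite /lhs /e /= !in_itv/=.
    by move=> [[[? ?] ?] [? ?]].
  by move=> [[[? ? ?] ?] ?].
have me : measurable e by rewrite eE; do 2 apply: measurableI => //.
have meW : measurable ((e `&` W n @^-1` G) `&` at_ n i).
  by apply: measurableI => //; exact: measurableI.
have mWi : measurable (W n @^-1` G `&` at_ n i) by exact: measurableI.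
have [Pi0|Pi0] := eqVneq (P (at_ n i)) 0%E.
  rewrite (subset_measure0 meW (mZ n i) _ Pi0); last by move=> w [].
  by rewrite (subset_measure0 mWi (mZ n i) _ Pi0) ?mulr0//; move=> w [].
have [ci law] := mp _ Pi0.
have ein : triple_events Z X X' n e.
  rewrite eE; apply: sigma_algebraI; first apply: sigma_algebraI.
  - by apply: sub_sigma_algebra; left; left; exact: events_preimage.
  - by apply: sub_sigma_algebra; left; right; exact: events_preimage.
  - by apply: sub_sigma_algebra; right; exact: state_events_preimage.
have Win : past Z W V S A C D n (W n @^-1` G).
  apply: sub_sigma_algebra; left; exists n => //=; left.
  exact: events_preimage.
have := ci _ _ ein Win; rewrite law// /cond_prob.
have Pi_neq0 : fine (P (at_ n i)) != 0.
  by apply: contra Pi0 => /eqP Pi0; rewrite -[P _]fineK ?fin_num_measure// Pi0.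
rewrite mulrA => /(congr1 ( *%R^~ (fine (P (at_ n i))))).
rewrite !divfK// => <-.
by rewrite fineK// fin_num_measure.
Qed.

Lemma V_split (v r : R) n G :
  P (V n @^-1` [set v]) = r%:E -> input_events Z W S A C D n G ->
  P (V n @^-1` [set v] `&` G) = (r%:E * P G)%E.
Proof.
move=> Pv inG.
have ind : independent_classes P (events (V n)) (input_events Z W S A C D n).
  exact: (V_indep_input M).
by rewrite ind ?Pv//; exact: events_preimage.
Qed.

Local Notation step n i j := (at_ n i `&` at_ n.+1 j).
Local Notation up n := (fun w => W n w + S n w - A n.+1 w).
Local Notation down n := (fun w => D n.+1 w - (W n w + C n w)).
Local Notation decay s u :=
  (fun w => cexp (- s * (Num.max (u w) 0)%:C)).

Let mstep n i j : measurable (step n i j).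
Proof. exact: measurableI. Qed.

Let mup n : measurable_fun setT (up n).
Proof. by apply: measurable_funB => //; exact: measurable_funD. Qed.

Let mdown n : measurable_fun setT (down n).
Proof. by apply: measurable_funB => //; exact: measurable_funD. Qed.

Let mRV (X : {RV P >-> R}) :
  measurable_fun setT (X : T -> measurableTypeR R).
Proof. exact: (measurable_funPT X). Qed.

Lemma transformWE n i s : transformW Z W n i s =
  Cintegral P (at_ n i) (fun w => cexp (- s * (W n w)%:C)).
Proof. by rewrite /transformW Cintegral_setT_indic. Qed.

(** Convergence is assumed for the transforms only. Reading P(Z_n = i) as the transform at 0 lets it
    pass to the limit together with the other terms. *)
Lemma transformW0 n i : transformW Z W n i 0 = (fine (P (at_ n i)))%:C.
Proof.
rewrite transformWE -[RHS]mul1r -Cintegral_cst//.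
by apply: eq_Cintegral => w _; rewrite oppr0 mul0r cexp0.
Qed.

Lemma up_transform n i j s : 0 <= Re s ->
  (s - (lam j)%:C) * Cintegral P (step n i j) (decay s (up n)) =
  (Pm i j)%:C *
    (s * LST (FB i) (lam j)%:C * transformW Z W n i (lam j)%:C -
     (lam j)%:C * LST (FB i) s * transformW Z W n i s).
Proof.
move=> s0; rewrite !transformWE.
apply: (@transform_under R d T P (FB i) (lam j) (lam_gt0 M j) (Pm i j) _
  (at_ n i) (step n i j) (mZ n i) (mstep n i j) (W n) (S n) (A n.+1)) => //.
- exact: (Z_stochastic M).1.
- by move=> y; exact: (FB_supp M).
- by move=> w; exact: (W_ge0 M).
- by move=> w; exact: (S_ge0 M).
- by move=> w; exact: (A_ge0 M).
- have law : modulated_pair Pm Z W V S A C D FB lam (A n.+1) (S n) n.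
    exact: (AS_law M).
  move=> G x y mG x0 y0.
  exact: (modulated_cdf i j law mG x0 y0).
Qed.

Lemma down_transform n i j s : 0 <= Re s ->
  (s + (mu j)%:C) * Cintegral P (step n i j) (decay s (down n)) =
  (Pm i j)%:C *
    ((s + (mu j)%:C) * transformW Z W n i 0 -
     s * LST (FC i) (mu j)%:C * transformW Z W n i (mu j)%:C).
Proof.
move=> s0; rewrite transformW0 !transformWE.
apply: (@transform_over R d T P (FC i) (mu j) (mu_gt0 M j) (Pm i j) _
  (at_ n i) (step n i j) (mZ n i) (mstep n i j) (W n) (C n) (D n.+1)) => //.
- exact: (Z_stochastic M).1.
- by move=> y; exact: (FC_supp M).
- by move=> w; exact: (W_ge0 M).
- by move=> w; exact: (C_ge0 M).
- by move=> w; exact: (D_ge0 M).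
- have law : modulated_pair Pm Z W V S A C D FC mu (D n.+1) (C n) n.
    exact: (DC_law M).
  move=> G x y mG x0 y0.
  exact: (modulated_cdf i j law mG x0 y0).
Qed.

Local Notation gens n := (events (W n) `|`
  \bigcup_k (state_events (Z k) `|` events (S k) `|` events (A k.+1)
             `|` events (C k) `|` events (D k.+1))).

(** T is given the sigma-algebra of the inputs. That an event about [up n] or [down n] is an input
    event then follows from measurability of sums and differences. *)
Lemma sub_measurable n (X : T -> R) : events X `<=` gens n ->
  measurable_fun setT (X : g_sigma_algebraType (gens n) -> R).
Proof.
move=> XG _ B mB; rewrite setTI; apply: sub_sigma_algebra; apply: XG.
exact: events_preimage.
Qed.

Lemma input_up n B : measurable B -> input_events Z W S A C D n (up n @^-1` B).
Proof.
move=> mB; pose T' := g_sigma_algebraType (gens n).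
suff : measurable_fun setT (up n : T' -> R).
  by move=> /(_ measurableT _ mB); rewrite setTI.
apply: measurable_funB; first apply: measurable_funD; apply: sub_measurable.
- exact: subsetUl.
- by move=> E ?; right; exists n => //; left; left; left; right.
- by move=> E ?; right; exists n => //; left; left; right.
Qed.

Lemma input_down n B : measurable B ->
  input_events Z W S A C D n (down n @^-1` B).
Proof.
move=> mB; pose T' := g_sigma_algebraType (gens n).
suff : measurable_fun setT (down n : T' -> R).
  by move=> /(_ measurableT _ mB); rewrite setTI.
apply: measurable_funB; last apply: measurable_funD; apply: sub_measurable.
- by move=> E ?; right; exists n => //; right.
- exact: subsetUl.
- by move=> E ?; right; exists n => //; left; right.
Qed.

Lemma input_step n i j : input_events Z W S A C D n (step n i j).
Proof.
have H k l : input_events Z W S A C D n (at_ k l).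
  apply: sub_sigma_algebra; right; exists k => //; left; left; left; left.
  exact: state_events_preimage.
by apply: sigma_algebraI; exact: H.
Qed.

Lemma V_Cintegral (v r : R) n i j (u : T -> R) s :
  P (V n @^-1` [set v]) = r%:E -> 0 <= Re s -> measurable_fun setT u ->
  (forall B, measurable B -> input_events Z W S A C D n (u @^-1` B)) ->
  Cintegral P (V n @^-1` [set v] `&` step n i j) (decay s u) =
  r%:C * Cintegral P (step n i j) (decay s u).
Proof.
move=> Pv s0 mu_meas inu; have mV : measurable (V n @^-1` [set v]) by [].
have r0 : 0 <= r by rewrite -lee_fin -Pv.
have mE : measurable (V n @^-1` [set v] `&` step n i j) by exact: measurableI.
apply: (Cintegral_proportional mE (mstep n i j) mu_meas mu_meas r0 _
  (bounded_cmfun_decay s0)).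
move=> B mB; rewrite [X in P X = _]setICA; apply: (V_split Pv).
by apply: sigma_algebraI; [exact: inu|exact: input_step].
Qed.

Lemma transform_split n j s : 0 <= Re s ->
  transformW Z W n.+1 j s =
  \sum_i (p%:C * Cintegral P (step n i j) (decay s (up n)) +
          (1 - p)%:C * Cintegral P (step n i j) (decay s (down n))).
Proof.
move=> s0; rewrite transformWE; set f := fun w => _.
have cf : bounded_cmfun f.
  have := bounded_cmfun_comp (T' := R) (u := W n.+1) _ (bounded_cmfun_decay s0).
  have -> : (fun r : R => cexp (- s * (Num.max r 0)%:C)) \o W n.+1 = f.
    by apply/funext => w; rewrite /f /= max_l// (W_ge0 M).
  exact.
pose V1 := V n @^-1` [set 1]; pose V2 := V n @^-1` [set -1].
have mV1 : measurable V1 by exact: measurable_funPTI.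
have mV2 : measurable V2 by exact: measurable_funPTI.
have PV1 : P V1 = p%:E by exact: (V_pos M).
have PV2 : P V2 = (1 - p)%:E by exact: (V_neg M).
have V12 w : V1 w -> V2 w -> False.
  rewrite /V1 /V2 /= => ->; lra.
(* The probabilities of V_n = 1 and V_n = -1 add up to 1, so the remaining event is null and its
   part of the integral drops out. *)
pose rest := ~` (V1 `|` V2).
have mrest : measurable rest by apply: measurableC; exact: measurableU.
have rest0 : P rest = 0%E.
  rewrite probability_setC; last exact: measurableU.
  rewrite measureU//; last by apply/seteqP; split => // w [/V12].
  rewrite [X in (_ - (X + _))%E]PV1 [X in (_ - (_ + X))%E]PV2.
  by rewrite -EFinD subrKC subrr.
have split3 : at_ n.+1 j = (V1 `&` at_ n.+1 j `|` V2 `&` at_ n.+1 j) `|`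
                           (rest `&` at_ n.+1 j).
  by rewrite -!setIUl setUCr setTI.
have stepE v : v `&` at_ n.+1 j = \bigcup_i (v `&` step n i j).
  apply/seteqP; split => w; first by move=> [vw Zw]; exists (Z n w).
  by move=> [i _ [? []]].
rewrite [in LHS]split3 Cintegral_setU//; last 3 first.
- by apply: measurableU; exact: measurableI.
- exact: measurableI.
- apply/disj_setPS => w [[[? _]|[? _]] [+ _]]; apply; [by left|by right].
rewrite [X in _ + X]Cintegral_null//; last 2 first.
- exact: measurableI.
- apply: (subset_measure0 _ mrest _ rest0); first exact: measurableI.
  by move=> w [].
rewrite addr0 Cintegral_setU//; last 3 first.
- exact: measurableI.
- exact: measurableI.
- by apply/disj_setPS => w [[/V12 h _] [/h]].
rewrite (stepE V1) (stepE V2).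
have tI v : trivIset setT (fun i => v `&` step n i j).
  by move=> i i' _ _ [w [[_ [<- _]] [_ [<- _]]]].
rewrite !Cintegral_partition//; try by move=> i; exact: measurableI.
rewrite -big_split/=; apply: eq_bigr => i _; congr (_ + _).
  rewrite -[RHS](V_Cintegral i j (V_pos M n) s0 (mup n) (@input_up n)).
  apply: eq_Cintegral => w [Vw _]; rewrite /f (W_rec M) Vw (Y_pos M) mul1r.
  by rewrite addrA.
rewrite -[RHS](V_Cintegral i j (V_neg M n) s0 (mdown n) (@input_down n)).
apply: eq_Cintegral => w [Vw _]; rewrite /f (W_rec M) Vw (Y_neg M) mulN1r.
by rewrite addrCA -opprD.
Qed.

Lemma transform_recursion n j s : 0 <= Re s ->
  (s - (lam j)%:C) * (s + (mu j)%:C) * transformW Z W n.+1 j s =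
  (s + (mu j)%:C) * p%:C * \sum_i (Pm i j)%:C *
    (s * LST (FB i) (lam j)%:C * transformW Z W n i (lam j)%:C -
     (lam j)%:C * LST (FB i) s * transformW Z W n i s) +
  (s - (lam j)%:C) * (1 - p)%:C * \sum_i (Pm i j)%:C *
    ((s + (mu j)%:C) * transformW Z W n i 0 -
     s * LST (FC i) (mu j)%:C * transformW Z W n i (mu j)%:C).
Proof.
move=> s0; rewrite transform_split// !mulr_sumr -big_split/=.
apply: eq_bigr => i _; rewrite -up_transform// -down_transform//; ring.
Qed.

End ModelStep.

(** * The limit *)

Section StationaryUnique.
Context {R : realType} {N : nat} (Pm : 'M[R]_N).
Hypotheses (stoP : stochastic Pm) (irrP : irreducible Pm).

Lemma expmx_ge0 n i j : 0 <= (Pm ^+ n) i j.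
Proof.
elim: n i j => [|n IH] i j; first by rewrite expr0 mxE; case: eqP.
by rewrite exprS mxE sumr_ge0// => k _; rewrite mulr_ge0// stoP.1.
Qed.

Lemma invariant_pos (e : 'rV[R]_N) (i : 'I_N) :
  (forall j, 0 <= e 0 j) -> e *m Pm = e -> 0 < e 0 i -> forall j, 0 < e 0 j.
Proof.
move=> e0 eP ei j; have [n Pn] := irrP i j.
have {eP} -> : e = e *m (Pm ^+ n).
  elim: n {Pn} => [|n IH]; first by rewrite expr0 mulmx1.
  have -> : Pm ^+ n.+1 = (Pm ^+ n) *m Pm by exact: exprSr.
  by rewrite mulmxA -IH eP.
rewrite mxE (bigD1 i)//= ltr_pwDl ?mulr_gt0//.
by rewrite sumr_ge0// => k _; rewrite mulr_ge0// expmx_ge0.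
Qed.

Lemma invariant_sum0_le0 (v : 'rV[R]_N) :
  v *m Pm = v -> \sum_j v 0 j = 0 -> forall i, v 0 i <= 0.
Proof.
move=> vP v0 i; rewrite leNgt; apply/negP => vi.
(* |v| is invariant as well, so |v| + v is a nonnegative invariant vector. *)
pose a : 'rV[R]_N := \row_j `|v 0 j|.
have aP_ge j : a 0 j <= (a *m Pm) 0 j.
  rewrite !mxE -[in leLHS]vP mxE; apply: (le_trans (ler_norm_sum _ _ _)).
  apply: ler_sum => k _; rewrite mxE normrM ler_wpM2l//.
  by rewrite ger0_norm// stoP.1.
(* The rows of P sum to 1, so a P and a have the same total and each inequality in [aP_ge] is an
   equality. *)
have aP_sum : \sum_j ((a *m Pm) 0 j - a 0 j) = 0.
  rewrite sumrB; apply/eqP; rewrite subr_eq0; apply/eqP.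
  under eq_bigr do rewrite mxE.
  rewrite exchange_big/=; apply: eq_bigr => k _.
  by rewrite -mulr_sumr stoP.2 mulr1.
have aP : a *m Pm = a.
  apply/rowP => j; apply/eqP; rewrite -subr_eq0.
  have /psumr_eq0P -> // : forall j, true -> 0 <= (a *m Pm) 0 j - a 0 j.
  by move=> k _; rewrite subr_ge0.
(* Positivity at i spreads to all states by irreducibility. *)
have pos : forall j, 0 < (a + v) 0 j.
  apply: (@invariant_pos _ i); first 1 last.
  - by rewrite mulmxDl aP vP.
  - by rewrite !mxE gtr0_norm// addr_gt0.
  - by move=> j; rewrite !mxE -lerBlDr sub0r -normrN ler_norm.
(* |v_j| + v_j > 0 forces v_j > 0, which for all j contradicts the zero sum. *)
have vpos j : 0 < v 0 j.
  have := pos j; rewrite !mxE; case: (ltrgt0P (v 0 j)) => // [|->].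
    by move=> vj; rewrite addNr ltxx.
  by rewrite addr0 ltxx.
have : 0 < \sum_j v 0 j.
  rewrite (bigD1 i)//= ltr_pwDl// sumr_ge0// => j _; exact: ltW.
by rewrite v0 ltxx.
Qed.

Lemma invariant_sum0_eq0 (v : 'rV[R]_N) :
  v *m Pm = v -> \sum_j v 0 j = 0 -> v = 0.
Proof.
move=> vP v0; apply/rowP => i; rewrite [RHS]mxE; apply/eqP.
rewrite eq_le invariant_sum0_le0//=.
have := @invariant_sum0_le0 (- v) _ _ i; rewrite mxE oppr_le0; apply.
  by rewrite mulNmx vP.
by under eq_bigr do rewrite mxE; rewrite sumrN v0 oppr0.
Qed.

Lemma Re_sum (I : finType) (f : I -> R[i]) : Re (\sum_i f i) = \sum_i Re (f i).
Proof. by elim/big_rec2: _ => // i x y _; rewrite ReD => ->. Qed.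

Lemma Im_sum (I : finType) (f : I -> R[i]) : Im (\sum_i f i) = \sum_i Im (f i).
Proof. by elim/big_rec2: _ => // i x y _; rewrite ImD => ->. Qed.

(** A limit of transforms is a priori just a complex vector. Its real part minus [pst] and its
    imaginary part are real invariant vectors of sum 0, hence zero; signs are not assumed. *)
Lemma stationary_unique (pst : 'rV[R]_N) (u : 'rV[R[i]]_N) :
  stationary Pm pst -> u *m toC_mx Pm = u -> \sum_j u 0 j = 1 ->
  u = toC_mx pst.
Proof.
move=> [_ pst1 pstP] uP u1.
pose x : 'rV[R]_N := \row_j Re (u 0 j); pose y : 'rV[R]_N := \row_j Im (u 0 j).
have xP : x *m Pm = x.
  apply/rowP => j; rewrite !mxE -[in RHS]uP mxE Re_sum.
  by apply: eq_bigr => k _; rewrite !mxE ReM /= mulr0 subr0.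
have yP : y *m Pm = y.
  apply/rowP => j; rewrite !mxE -[in RHS]uP mxE Im_sum.
  by apply: eq_bigr => k _; rewrite !mxE ImM /= mulr0 add0r.
have x1 : \sum_j x 0 j = 1.
  by under eq_bigr do rewrite mxE; rewrite -Re_sum u1.
have y0 : \sum_j y 0 j = 0.
  by under eq_bigr do rewrite mxE; rewrite -Im_sum u1.
have /eqP : x - pst = 0.
  apply: invariant_sum0_eq0; first by rewrite mulmxBl xP pstP.
  under eq_bigr do rewrite mxE [(- pst) _ _]mxE.
  by rewrite sumrB x1 pst1 subrr.
rewrite subr_eq0 => /eqP xE.
have yE := invariant_sum0_eq0 yP y0.
apply/rowP => j; apply: complexP.
  by rewrite !mxE/= -xE mxE.
by have := congr1 (fun z : 'rV[R]_N => z 0 j) yE; rewrite !mxE.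
Qed.

End StationaryUnique.

(** Entry j of the claimed equation, multiplied by mu_j + s, with the sums as letters: x, y and z
    are those with beta_i(lambda_j), beta_i(s) and c_i(mu_j), w' is sum_i p_ij Phi_i(0) and w is
    pi_j. Thus p x is v_j^(1) and q (w - z) is v_j^(-1). *)
Lemma recursion_entry (K : comNzRingType) (l m p q s f x y z w w' : K) :
  (s - l) * (s + m) * f =
  (s + m) * p * (s * x - l * y) + (s - l) * q * ((s + m) * w' - s * z) ->
  w' = w ->
  (p * y * l + s * f - l * f) * (m + s) =
  s * (q * w * m + m * (p * x) - l * (q * (w - z))) +
  s ^+ 2 * (p * x + q * (w - z)) - q * (w * l * m).
Proof.
move=> e ew; transitivity (p * y * l * (m + s) + (s - l) * (s + m) * f).
  ring.
rewrite e ew; ring.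
Qed.

(** The zeros are left unsimplified so that the recursion at s = 0 fits the hypothesis as it stands;
    y' and y differ by the factors beta_i(0) = 1. *)
Lemma recursion_at0 (K : comNzRingType) (a b p q x y y' z f : K) :
  (0 - a) * (0 + b) * f =
  (0 + b) * p * (0 * x - a * y') + (0 - a) * q * ((0 + b) * y - 0 * z) ->
  y' = y -> q = 1 - p -> - a * b * f = - a * b * y.
Proof.
move=> e ey eq; transitivity ((0 - a) * (0 + b) * f); first ring.
rewrite e ey eq; ring.
Qed.

Section Limit.
Context {R : realType} {d : measure_display} {T : measurableType d}.
Context (P : probability T R) {N : nat}.
Context (p : R) (Pm : 'M[R]_N) (pst : 'rV[R]_N) (lam mu : 'I_N -> R).
Context (FB FC : 'I_N -> cumulativeBounded (0 : R) (1 : R)).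
Context (Z : nat -> T -> 'I_N).
Context (W V S A C D : nat -> {RV P >-> R}).
Context (Y : nat -> R -> T -> R).
Hypothesis M : modelII p Pm lam mu FB FC Z W V S A C D Y.
Hypothesis Hst : stationary Pm pst.
Hypothesis Hcv : transforms_converge Z W.

Local Notation Phi := (PhiW Z W).

Lemma PhiW_cvg i s : 0 <= Re s ->
  (transformW Z W n i s : R[i]^o) @[n --> \oo] --> (Phi i s : R[i]^o).
Proof. by move=> s0; exact: Hcv. Qed.

Lemma PhiW_cvg_sum (c : 'I_N -> R[i]) (s : 'I_N -> R[i]) :
  (forall i, 0 <= Re (s i)) ->
  (\sum_i c i * transformW Z W n i (s i) : R[i]^o) @[n --> \oo] -->
  (\sum_i c i * Phi i (s i) : R[i]^o).
Proof.
move=> s0; apply: cvg_big => [|i _]; first exact: add_continuous.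
by apply: cvgM; [exact: cvg_cst|exact: PhiW_cvg].
Qed.

Lemma LST0 (F : cumulativeBounded (0 : R) (1 : R)) :
  (forall y, y < 0 -> F y = 0) -> LST F 0 = 1.
Proof.
move=> F0; rewrite -LST_decay//.
rewrite (@eq_Cintegral _ _ _ _ _ _ (fun=> 1)); last first.
  by move=> t _; rewrite oppr0 mul0r cexp0.
by rewrite Cintegral_cst// [X in fine X]probability_setT mulr1.
Qed.

Lemma PhiW_recursion j s : 0 <= Re s ->
  (s - (lam j)%:C) * (s + (mu j)%:C) * Phi j s =
  (s + (mu j)%:C) * p%:C *
    (s * (\sum_i (Pm i j)%:C * LST (FB i) (lam j)%:C * Phi i (lam j)%:C) -
     (lam j)%:C * \sum_i (Pm i j)%:C * LST (FB i) s * Phi i s) +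
  (s - (lam j)%:C) * (1 - p)%:C *
    ((s + (mu j)%:C) * (\sum_i (Pm i j)%:C * Phi i 0) -
     s * \sum_i (Pm i j)%:C * LST (FC i) (mu j)%:C * Phi i (mu j)%:C).
Proof.
move=> s0; set lhs := LHS; set rhs := RHS.
have l0 : 0 <= Re ((lam j)%:C : R[i]) by rewrite /= ltW// (lam_gt0 M).
have m0 : 0 <= Re ((mu j)%:C : R[i]) by rewrite /= ltW// (mu_gt0 M).
have cl : ((s - (lam j)%:C) * (s + (mu j)%:C) * transformW Z W n.+1 j s : R[i]^o)
    @[n --> \oo] --> (lhs : R[i]^o).
  apply: cvgM; first exact: cvg_cst.
  (* The recursion expresses step n + 1 through step n, so on this side the limit is that of the
     shifted sequence. *)
  have := @PhiW_cvg j s s0; rewrite -(cvg_shiftS (V := R[i]^o)); exact.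
have cr : ((s - (lam j)%:C) * (s + (mu j)%:C) * transformW Z W n.+1 j s : R[i]^o)
    @[n --> \oo] --> (rhs : R[i]^o).
  (* Each sum is separated so that it contains one kind of transform with weights independent of n,
     the form covered by [PhiW_cvg_sum]. *)
  rewrite (_ : (fun n => _) = (fun n =>
    (s + (mu j)%:C) * p%:C *
    (s * (\sum_i (Pm i j)%:C * LST (FB i) (lam j)%:C *
                transformW Z W n i (lam j)%:C) -
     (lam j)%:C * \sum_i (Pm i j)%:C * LST (FB i) s * transformW Z W n i s) +
    (s - (lam j)%:C) * (1 - p)%:C *
    ((s + (mu j)%:C) * (\sum_i (Pm i j)%:C * transformW Z W n i 0) -
     s * \sum_i (Pm i j)%:C * LST (FC i) (mu j)%:C *
                transformW Z W n i (mu j)%:C)));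
    last first.
    apply/funext => n; rewrite (transform_recursion M)//.
    rewrite ![s * \sum_(_ < _) _]mulr_sumr ![_%:C * \sum_(_ < _) _]mulr_sumr.
    rewrite ![(s + _) * \sum_(_ < _) _]mulr_sumr -!sumrB.
    by congr (_ * _ + _ * _); apply: eq_bigr => i _; ring.
  apply: cvgD; apply: cvgM; try exact: cvg_cst; apply: cvgB; apply: cvgM;
    try exact: cvg_cst; exact: PhiW_cvg_sum.
exact: (cvg_unique _ cl cr).
Qed.

Lemma PhiW0_invariant j : \sum_i (Pm i j)%:C * Phi i 0 = Phi j 0.
Proof.
have lm : - (lam j)%:C * (mu j)%:C != 0 :> R[i].
  rewrite mulf_neq0// ?oppr_eq0 eq_complex /= eqxx andbT gt_eqF//.
    exact: (lam_gt0 M).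
  exact: (mu_gt0 M).
apply/esym/(mulfI lm); apply: (recursion_at0 (@PhiW_recursion j 0 (lexx 0))).
  apply: eq_bigr => i _; rewrite LST0 ?mulr1// => y; exact: (FB_supp M).
by apply: complexP; rewrite !ReIm /= ?subr0 ?oppr0 ?addr0.
Qed.

Lemma PhiW0_sum : \sum_i Phi i 0 = 1.
Proof.
have c1 : (\sum_i 1 * transformW Z W n i 0 : R[i]^o) @[n --> \oo] -->
    (\sum_i 1 * Phi i 0 : R[i]^o).
  by apply: (PhiW_cvg_sum (s := fun=> 0)) => i.
have c2 : (\sum_i 1 * transformW Z W n i 0 : R[i]^o) @[n --> \oo] -->
    (1 : R[i]^o).
  rewrite (_ : (fun n => _) = (fun=> 1)); first exact: cvg_cst.
  apply/funext => n.
  transitivity (\sum_i Cintegral P (Z n @^-1` [set i]) (fun=> 1)).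
    apply: eq_bigr => i _; rewrite mul1r (transformW0 M) Cintegral_cst ?mul1r//.
    exact: (Z_measurable M).
  rewrite -Cintegral_partition.
  - have -> : \bigcup_i (Z n @^-1` [set i]) = setT.
      by apply/seteqP; split => // w _; exists (Z n w).
    by rewrite Cintegral_cst// [X in fine X]probability_setT mulr1.
  - by move=> i; exact: (Z_measurable M).
  - by move=> i i' _ _ [w [<- <-]].
  - exact: bounded_cmfun_cst.
have e : \sum_i 1 * Phi i 0 = 1 by exact: (cvg_unique _ c1 c2).
by rewrite -[RHS]e; apply: eq_bigr => i _; rewrite mul1r.
Qed.

Lemma PhiW_row0 : PhiW_row Z W 0 = toC_mx pst.
Proof.
apply: (stationary_unique (Z_stochastic M) (Z_irreducible M) Hst).
  apply/rowP => j; rewrite !mxE -[RHS]PhiW0_invariant.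
  by apply: eq_bigr => i _; rewrite !mxE mulrC.
by rewrite -[RHS]PhiW0_sum; apply: eq_bigr => i _; rewrite mxE.
Qed.

Lemma PhiW_equation s : 0 <= Re s ->
  PhiW_row Z W s *m (Hmx p Pm lam FB s + s%:M - diagC lam)
  = vrow p Pm lam mu FB FC Z W pst s.
Proof.
(* Re(mu_j + s) >= mu_j > 0, so M + s I is invertible on the whole closed half-plane and the
   equation can be multiplied by it. *)
move=> s0; have mu_s j : (mu j)%:C + s != 0.
  apply/negP => /eqP/(congr1 (@complex.Re R)); rewrite ReD /= => h.
  have := mu_gt0 M j; lra.
have dE : diagC mu + s%:M = diag_mx (\row_j ((mu j)%:C + s)).
  rewrite /diagC -[s%:M]diag_const_mx -raddfD/=; congr diag_mx.
  by apply/rowP => j; rewrite !mxE.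
have du : diagC mu + s%:M \in unitmx.
  rewrite dE unitmxE det_diag unitfE; apply/prodf_neq0 => j _.
  by rewrite mxE.
apply: (canRL (mulmxK du)); rewrite dE mul_mx_diag.
apply/rowP => j; rewrite [LHS]mxE [X in _ * X]mxE.
set f := Phi j s; pose B := \sum_i (Pm i j)%:C * LST (FB i) s * Phi i s.
have -> : (PhiW_row Z W s *m (Hmx p Pm lam FB s + s%:M - diagC lam)) 0 j =
    p%:C * B * (lam j)%:C + s * f - (lam j)%:C * f.
  rewrite mulmxBr mulmxDr mul_mx_scalar /diagC mul_mx_diag !mxE.
  congr (_ + _ - _); last by rewrite mulrC.
  rewrite /B mulr_sumr mulr_suml; apply: eq_bigr => i _.
  have -> : Hmx p Pm lam FB s i j =
      p%:C * (LST (FB i) s * (Pm i j)%:C * (lam j)%:C).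
    by rewrite /Hmx mxE /diagC mul_mx_diag mxE /Bstar mul_diag_mx !mxE.
  by rewrite mxE; move: (LST _ _) (PhiW _ _ _ _) => x y; ring.
rewrite /diagC !mul_mx_diag !mxE.
apply: recursion_entry (PhiW_recursion j s0) _.
(* The sum over p_ij Phi_i(0) is Phi_j(0) by invariance, and this is pi_j by the claim at s = 0. *)
have := PhiW_row0; rewrite PhiW0_invariant => /rowP/(_ j).
by rewrite !mxE.
Qed.

End Limit.

Theorem theorem2 (R : realType) (d : measure_display) (T : measurableType d)
    (P : probability T R) (N : nat)
    (p : R) (Pm : 'M[R]_N) (pst : 'rV[R]_N) (lam mu : 'I_N -> R)
    (FB FC : 'I_N -> cumulativeBounded (0 : R) (1 : R))
    (Z : nat -> T -> 'I_N) (W V S A C D : nat -> {RV P >-> R})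
    (Y : nat -> R -> T -> R) :
  modelII p Pm lam mu FB FC Z W V S A C D Y ->
  stationary Pm pst ->
  transforms_converge Z W ->
  (forall s : R[i], 0 <= complex.Re s ->
     PhiW_row Z W s *m (Hmx p Pm lam FB s + s%:M - diagC lam)
     = vrow p Pm lam mu FB FC Z W pst s)
  /\ PhiW_row Z W 0 = toC_mx pst.
Proof.
move=> M Hst Hcv; split; first exact: (PhiW_equation M Hst Hcv).
exact: (PhiW_row0 M Hst Hcv).
Qed.
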